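(* Let $\Bbbk$ be a field and let $A$ be a connected graded Artin-Schelter regular $\Bbbk$-algebra (equivalently, a connected graded skew Calabi-Yau algebra). Let $\mu_A$ be its (graded) Nakayama automorphism. Let $H=\Bbbk\mathbb Z$ and consider the action of $H$ on $A$ induced by $\mu_A$ (the generator of $\mathbb Z$ acts by $\mu_A$). Then $\mathrm{hdet}(\mu_A)=1$, where $\mathrm{hdet}(\mu_A)$ denotes the value of $\mathrm{hdet}\colon H\to\Bbbk$ on the generator of $\mathbb Z$.
   Context: $\otimes=\otimes_\Bbbk$. Connected graded: $A=\bigoplus_{m\ge0}A_m$, $A_0=\Bbbk$. $A$ is Artin-Schelter regular in dimension $n$ if $\mathrm{Ext}^i_A({}_A\Bbbk,A)$ and $\mathrm{Ext}^i_{A^{\mathrm{op}}}(\Bbbk_A,A)$ are one-dimensional for $i=n$ and $0$ otherwise, the injective dimensions of ${}_AA$ and $A_A$ are finite and equal, and $A$ has finite global dimension. With $A^e=A\otimes A^{\mathrm{op}}$, $A$ is skew Calabi-Yau in dimension $n$ if $A\in\mathrm{per}(A^e)$, $\mathrm{Ext}^i_{A^e}(A,A^e)=0$ for $i\ne n$, and $\mathrm{Ext}^n_{A^e}(A,A^e)$ is an invertible bimodule isomorphic to $A^{\mu}$ for some algebra automorphism $\mu$ of $A$, where $A^\mu$ is $A$ with $a\cdot x\cdot b=ax\mu(b)$. In the connected graded case there is a homogeneous free generator $e_A$ of the left $A$-module $\mathrm{Ext}^n_{A^e}(A,A^e)$, unique up to scalar, and the graded Nakayama automorphism $\mu_A$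 is given by $e_Aa=\mu_A(a)e_A$. Homological determinant for a group acting by graded automorphisms: let $P\to A$ be a projective resolution in the category of $A$-bimodules $M$ with a compatible group action $g\rightharpoonup(amb)=(g\rightharpoonup a)(g\rightharpoonup m)(g\rightharpoonup b)$ (it is also an $A^e$-projective resolution). The group acts on $\mathrm{Hom}_{A^e}(P,A^e)$ by $(g\rightharpoonup\varphi)(p)=(g\otimes g)\rightharpoonup\varphi(g^{-1}\rightharpoonup p)$ and hence on $\mathrm{Ext}^n_{A^e}(A,A^e)$; $\mathrm{hdet}\colon H\to\Bbbk$ is the algebra homomorphism with $g\rightharpoonup e_A=\mathrm{hdet}(g^{-1})e_A$ for group elements $g$. *)

(* Defs.v *)
From HB Require Import structures.
From mathcomp Require Import all_boot all_order all_algebra.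
From mathcomp Require Import boolp.

Set Implicit Arguments.
Unset Strict Implicit.
Unset Printing Implicit Defensive.

Import GRing.Theory.
Local Open Scope ring_scope.
Local Open Scope quotient_scope.

(* Both A (x) A^op and k[Z] are the free k-module on a multiplicative monoid X
  (A x A^op, resp. Z) modulo the linear relations satisfied by every "test"
  function from X to a k-module: bilinear functions for the tensor product,
  all functions for the group algebra. By construction, test functions
  X -> W are the same thing as k-linear maps from the quotient to W. *)

Record alg_pres (k : fieldType) := AlgPres {
  ap_gen : choiceType;
  ap_one : ap_gen;
  ap_mul : ap_gen -> ap_gen -> ap_gen;
  ap_test : forall W : lmodType k, (ap_gen -> W) -> Prop;
  ap_mulA : associative ap_mul;
  ap_mul1 : left_id ap_one ap_mul;
  ap_mulr1 : right_id ap_one ap_mul;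
  ap_testl : forall (W : lmodType k) (f : ap_gen -> W) x,
    ap_test f -> ap_test (fun y => f (ap_mul x y));
  ap_testr : forall (W : lmodType k) (f : ap_gen -> W) y,
    ap_test f -> ap_test (fun x => f (ap_mul x y));
  ap_nontriv : exists (W : lmodType k) (f : ap_gen -> W),
    ap_test f /\ f ap_one <> 0
}.

Section PresentedAlgebra.
Variables (k : fieldType) (D : alg_pres k).
Local Notation X := (ap_gen D).
Local Notation "x ** y" := (ap_mul x y) (at level 40, left associativity).

(* A list of pairs (c, x) stands for the formal sum of the c x. *)
Definition pa_eval (W : lmodType k) (f : X -> W) (s : seq (k * X)) : W :=
  \sum_(p <- s) p.1 *: f p.2.

Definition pa_rel (s t : seq (k * X)) : bool :=
  `[< forall (W : lmodType k) (f : X -> W),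
      ap_test f -> pa_eval f s = pa_eval f t >].

Fact pa_rel_refl : reflexive pa_rel.
Proof. by move=> s; apply/asboolP. Qed.
Fact pa_rel_sym : symmetric pa_rel.
Proof.
by move=> s t; apply/asboolP/asboolP => h W f tf; rewrite (h W f tf).
Qed.
Fact pa_rel_trans : transitive pa_rel.
Proof.
move=> t s u /asboolP h1 /asboolP h2; apply/asboolP => W f tf.
by rewrite (h1 W f tf) (h2 W f tf).
Qed.
Canonical pa_equiv := EquivRel pa_rel pa_rel_refl pa_rel_sym pa_rel_trans.

Definition palg := {eq_quot pa_equiv}.
HB.instance Definition _ := Choice.on palg.

Definition pa_pi (s : seq (k * X)) : palg := \pi s.
Definition pa_gen (x : X) : palg := pa_pi [:: (1, x)].

(* For a test function f this is the linear map induced by f. *)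
Definition pa_lift (W : lmodType k) (f : X -> W) (t : palg) : W :=
  pa_eval f (repr t).

Lemma pa_lift_pi (W : lmodType k) (f : X -> W) s :
  ap_test f -> pa_lift f (pa_pi s) = pa_eval f s.
Proof.
move=> tf; rewrite /pa_lift /pa_pi; case: piP => t /eqmodP /asboolP h.
by rewrite (h W f tf).
Qed.

Lemma pa_liftP (x y : palg) :
  (forall (W : lmodType k) (f : X -> W),
     ap_test f -> pa_lift f x = pa_lift f y) -> x = y.
Proof.
move=> h; rewrite -[x]reprK -[y]reprK; apply/eqmodP/asboolP => W f.
exact: h.
Qed.

Definition pa_zero : palg := pa_pi [::].
Definition pa_opp (x : palg) := pa_pi [seq (- p.1, p.2) | p <- repr x].
Definition pa_add (x y : palg) := pa_pi (repr x ++ repr y).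
Definition pa_scale (c : k) (x : palg) :=
  pa_pi [seq (c * p.1, p.2) | p <- repr x].
Definition pa_one : palg := pa_gen (ap_one D).
Definition pa_mul (x y : palg) :=
  pa_pi [seq (p.1 * q.1, p.2 ** q.2) | p <- repr x, q <- repr y].

Section Lift.
Variables (W : lmodType k) (f : X -> W).
Hypothesis tf : ap_test f.

Lemma pa_lift0 : pa_lift f pa_zero = 0.
Proof. by rewrite pa_lift_pi // /pa_eval big_nil. Qed.
Lemma pa_liftN x : pa_lift f (pa_opp x) = - pa_lift f x.
Proof.
rewrite pa_lift_pi // /pa_lift /pa_eval big_map -sumrN.
by apply: eq_bigr => p _; rewrite scaleNr.
Qed.
Lemma pa_liftD x y : pa_lift f (pa_add x y) = pa_lift f x + pa_lift f y.
Proof. by rewrite pa_lift_pi // /pa_eval big_cat. Qed.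
Lemma pa_liftZ c x : pa_lift f (pa_scale c x) = c *: pa_lift f x.
Proof.
rewrite pa_lift_pi // /pa_lift /pa_eval big_map scaler_sumr.
by apply: eq_bigr => p _; rewrite scalerA.
Qed.
Lemma pa_lift_gen x : pa_lift f (pa_gen x) = f x.
Proof. by rewrite pa_lift_pi // /pa_eval big_seq1 scale1r. Qed.
Lemma pa_liftM x y : pa_lift f (pa_mul x y) =
  \sum_(p <- repr x) p.1 *: pa_lift (fun b => f (p.2 ** b)) y.
Proof.
rewrite pa_lift_pi // /pa_lift /pa_eval big_allpairs_dep.
apply: eq_bigr => p _; rewrite scaler_sumr.
by apply: eq_bigr => q _; rewrite scalerA.
Qed.
Lemma pa_liftMr x y : pa_lift f (pa_mul x y) =
  \sum_(q <- repr y) q.1 *: pa_lift (fun a => f (a ** q.2)) x.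
Proof.
rewrite pa_liftM /pa_lift /pa_eval.
under eq_bigr do rewrite scaler_sumr.
rewrite exchange_big /=; apply: eq_bigr => q _; rewrite scaler_sumr.
by apply: eq_bigr => p _; rewrite !scalerA mulrC.
Qed.
End Lift.

Fact pa_addA : associative pa_add.
Proof. by move=> x y z; apply: pa_liftP => W f tf; rewrite !pa_liftD ?addrA. Qed.
Fact pa_addC : commutative pa_add.
Proof. by move=> x y; apply: pa_liftP => W f tf; rewrite !pa_liftD // addrC. Qed.
Fact pa_add0 : left_id pa_zero pa_add.
Proof.
by move=> x; apply: pa_liftP => W f tf; rewrite pa_liftD // pa_lift0 // add0r.
Qed.
Fact pa_addN : left_inverse pa_zero pa_opp pa_add.
Proof.
move=> x; apply: pa_liftP => W f tf.
by rewrite pa_liftD // pa_liftN // pa_lift0 // addNr.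
Qed.
HB.instance Definition _ :=
  GRing.isZmodule.Build palg pa_addA pa_addC pa_add0 pa_addN.

Fact pa_scaleA a b (v : palg) :
  pa_scale a (pa_scale b v) = pa_scale (a * b) v.
Proof. by apply: pa_liftP => W f tf; rewrite !pa_liftZ // scalerA. Qed.
Fact pa_scale1 : left_id 1 pa_scale.
Proof. by move=> x; apply: pa_liftP => W f tf; rewrite pa_liftZ // scale1r. Qed.
Fact pa_scaleDr : right_distributive pa_scale +%R.
Proof.
move=> c x y; apply: pa_liftP => W f tf.
by rewrite pa_liftZ // [in LHS]pa_liftD // pa_liftD // !pa_liftZ // scalerDr.
Qed.
Fact pa_scaleDl (v : palg) : {morph pa_scale^~ v : a b / a + b}.
Proof.
move=> a b; apply: pa_liftP => W f tf.
by rewrite pa_liftZ // pa_liftD // !pa_liftZ // scalerDl.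
Qed.
HB.instance Definition _ := GRing.Zmodule_isLmodule.Build k palg
  pa_scaleA pa_scale1 pa_scaleDr pa_scaleDl.

Fact pa_mulA : associative pa_mul.
Proof.
move=> x y z; apply: pa_liftP => W f tf.
rewrite pa_liftM // [RHS]pa_liftMr //.
under eq_bigr do rewrite (pa_liftMr (ap_testl _ tf)) scaler_sumr.
rewrite exchange_big /=; apply: eq_bigr => q _.
rewrite (pa_liftM (ap_testr _ tf)) scaler_sumr.
apply: eq_bigr => p _; rewrite !scalerA mulrC; congr (_ *: pa_lift _ _).
by apply/funext => b; rewrite ap_mulA.
Qed.
Fact pa_mul1 : left_id pa_one pa_mul.
Proof.
move=> x; apply: pa_liftP => W f tf; rewrite pa_liftMr //.
rewrite [RHS]/pa_lift /pa_eval; apply: eq_bigr => q _.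
by rewrite (pa_lift_gen (ap_testr _ tf)) ap_mul1.
Qed.
Fact pa_mulr1 : right_id pa_one pa_mul.
Proof.
move=> x; apply: pa_liftP => W f tf; rewrite pa_liftM //.
rewrite [RHS]/pa_lift /pa_eval; apply: eq_bigr => q _.
by rewrite (pa_lift_gen (ap_testl _ tf)) ap_mulr1.
Qed.
Fact pa_mulDl : left_distributive pa_mul +%R.
Proof.
move=> x y z; apply: pa_liftP => W f tf.
rewrite [RHS]pa_liftD // !pa_liftMr // -big_split /=.
by apply: eq_bigr => q _; rewrite (pa_liftD (ap_testr _ tf)) scalerDr.
Qed.
Fact pa_mulDr : right_distributive pa_mul +%R.
Proof.
move=> x y z; apply: pa_liftP => W f tf.
rewrite [RHS]pa_liftD // !pa_liftM // -big_split /=.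
by apply: eq_bigr => q _; rewrite (pa_liftD (ap_testl _ tf)) scalerDr.
Qed.
Fact pa_oner_neq0 : pa_one != 0 :> palg.
Proof.
have [W [f [tf nz]]] := ap_nontriv D.
apply/eqP => /(congr1 (pa_lift f)); rewrite pa_lift_gen // => h.
by apply: nz; rewrite h; apply: pa_lift0.
Qed.
HB.instance Definition _ := GRing.Zmodule_isNzRing.Build palg
  pa_mulA pa_mul1 pa_mulr1 pa_mulDl pa_mulDr pa_oner_neq0.

Fact pa_scaleAl (c : k) (x y : palg) : c *: (x * y) = (c *: x) * y.
Proof.
apply: pa_liftP => W f tf; rewrite pa_liftZ // !pa_liftMr // scaler_sumr.
apply: eq_bigr => q _.
by rewrite (pa_liftZ (ap_testr _ tf)) !scalerA mulrC.
Qed.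
HB.instance Definition _ := GRing.Lmodule_isLalgebra.Build k palg pa_scaleAl.
Fact pa_scaleAr (c : k) (x y : palg) : c *: (x * y) = x * (c *: y).
Proof.
apply: pa_liftP => W f tf; rewrite pa_liftZ // !pa_liftM // scaler_sumr.
apply: eq_bigr => q _.
by rewrite (pa_liftZ (ap_testl _ tf)) !scalerA mulrC.
Qed.
HB.instance Definition _ := GRing.Lalgebra_isAlgebra.Build k palg pa_scaleAr.

Lemma pa_genM x y : pa_gen x * pa_gen y = pa_gen (x ** y).
Proof.
apply: pa_liftP => W f tf.
rewrite (pa_liftM tf) pa_lift_gen //.
under eq_bigr do rewrite (pa_lift_gen (ap_testl _ tf)).
exact: (pa_lift_gen (ap_testr y tf)).
Qed.
End PresentedAlgebra.

Section Enveloping.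
Variables (k : fieldType) (A : algType k).

Definition env_mul (p q : A * A) : A * A := (p.1 * q.1, q.2 * p.2).
Definition bilinear_on (W : lmodType k) (f : A * A -> W) : Prop :=
  (forall b, linear (fun a => f (a, b))) /\
  (forall a, linear (fun b => f (a, b))).

Fact env_mulA : associative env_mul.
Proof. by move=> p q r; rewrite /env_mul /= !mulrA. Qed.
Fact env_mul1 : left_id ((1, 1) : A * A) env_mul.
Proof. by move=> [a b]; rewrite /env_mul /= mul1r mulr1. Qed.
Fact env_mulr1 : right_id ((1, 1) : A * A) env_mul.
Proof. by move=> [a b]; rewrite /env_mul /= mul1r mulr1. Qed.
Fact env_testl (W : lmodType k) (f : A * A -> W) x :
  bilinear_on f -> bilinear_on (fun y => f (env_mul x y)).
Proof.
case=> h1 h2; split=> [b|a] c u v; rewrite /env_mul /=.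
  by rewrite mulrDr -scalerAr; apply: h1.
by rewrite mulrDl -scalerAl; apply: h2.
Qed.
Fact env_testr (W : lmodType k) (f : A * A -> W) y :
  bilinear_on f -> bilinear_on (fun x => f (env_mul x y)).
Proof.
case=> h1 h2; split=> [b|a] c u v; rewrite /env_mul /=.
  by rewrite mulrDl -scalerAl; apply: h1.
by rewrite mulrDr -scalerAr; apply: h2.
Qed.
Fact env_nontriv : exists (W : lmodType k) (f : A * A -> W),
  bilinear_on f /\ f (1, 1) <> 0.
Proof.
exists A, (fun p => p.1 * p.2); split.
  split=> [b|a] c u v /=; first by rewrite mulrDl scalerAl.
  by rewrite mulrDr scalerAr.
by rewrite /= mulr1; apply/eqP/oner_neq0.
Qed.

Definition env_pres : alg_pres k :=
  AlgPres env_mulA env_mul1 env_mulr1 env_testl env_testr env_nontriv.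

(* A^e = A (x) A^op: the product is (a (x) b)(a' (x) b') = aa' (x) b'b. *)
Definition Aenv := palg env_pres.
HB.instance Definition _ := GRing.Algebra.on Aenv.

Definition tens (a b : A) : Aenv := pa_gen (D := env_pres) (a, b).

Lemma tensM a b a' b' : tens a b * tens a' b' = tens (a * a') (b' * b).
Proof. exact: pa_genM. Qed.

Lemma tens_bilinear : bilinear_on (fun p => tens p.1 p.2).
Proof.
split=> [b|a] c u v; apply: pa_liftP => W f tf.
  rewrite pa_liftD // pa_liftZ // !pa_lift_gen //; exact: tf.1.
rewrite pa_liftD // pa_liftZ // !pa_lift_gen //; exact: tf.2.
Qed.

(* g (x) g acting on A^e. *)
Definition Aenv_map (g : {lrmorphism A -> A}) (t : Aenv) : Aenv :=
  pa_lift (D := env_pres) (fun p => tens (g p.1) (g p.2)) t.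

Lemma Aenv_map_tens (g : {lrmorphism A -> A}) a b :
  Aenv_map g (tens a b) = tens (g a) (g b).
Proof.
apply: (@pa_lift_gen k env_pres Aenv (fun p => tens (g p.1) (g p.2)) _ (a, b)).
split=> [b'|a'] c u v; rewrite linearP.
  exact: (tens_bilinear.1 (g b')).
exact: (tens_bilinear.2 (g a')).
Qed.

(* A with its left A^e-module structure (a (x) b) x = a x b. *)
Definition Abim : Type := A.
HB.instance Definition _ := GRing.Zmodule.on Abim.

Definition Abim_scale (t : Aenv) (x : Abim) : Abim :=
  pa_lift (D := env_pres) (fun p : A * A => p.1 * (x : A) * p.2 : A) t.

Lemma Abim_test (x : A) :
  @ap_test k env_pres A (fun p : A * A => p.1 * x * p.2).
Proof.
split=> [b|a] c u v /=; first by rewrite !mulrDl -!scalerAl.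
by rewrite mulrDr -scalerAr.
Qed.

Fact Abim_scaleA a b v :
  Abim_scale a (Abim_scale b v) = Abim_scale (a * b) v.
Proof.
rewrite /Abim_scale [RHS](pa_liftM (Abim_test v)) {1}/pa_lift /pa_eval.
apply: eq_bigr => p _; congr (_ *: _); rewrite /pa_lift /pa_eval.
rewrite mulr_sumr mulr_suml; apply: eq_bigr => q _.
by rewrite -scalerAr -scalerAl /= !mulrA.
Qed.
Fact Abim_scale1 : left_id 1 Abim_scale.
Proof.
by move=> v; rewrite /Abim_scale (pa_lift_gen (Abim_test v)) /= mul1r mulr1.
Qed.
Fact Abim_scaleDr : right_distributive Abim_scale +%R.
Proof.
move=> t u v; rewrite /Abim_scale /pa_lift /pa_eval -big_split /=.
by apply: eq_bigr => p _; rewrite mulrDr mulrDl scalerDr.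
Qed.
Fact Abim_scaleDl v : {morph Abim_scale^~ v : a b / a + b}.
Proof. by move=> a b; rewrite /Abim_scale (pa_liftD (Abim_test v)). Qed.
HB.instance Definition _ := GRing.Zmodule_isLmodule.Build Aenv Abim
  Abim_scaleA Abim_scale1 Abim_scaleDr Abim_scaleDl.

Lemma tens_Abim (a b : A) (x : Abim) : tens a b *: x = a * (x : A) * b :> A.
Proof. exact: (pa_lift_gen (Abim_test x)). Qed.
End Enveloping.

Section GroupAlgebra.
Variable k : fieldType.

Definition ZZ_test (W : lmodType k) (f : int -> W) : Prop := True.
Fact ZZ_nontriv : exists (W : lmodType k) (f : int -> W),
  ZZ_test f /\ f 0 <> 0.
Proof. by exists (k^o)%type, (fun=> 1); split=> //; apply/eqP/oner_neq0. Qed.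

Definition ZZ_pres : alg_pres k :=
  @AlgPres k int 0 +%R ZZ_test (@addrA int) (@add0r int) (@addr0 int)
    (fun _ _ _ _ => I) (fun _ _ _ _ => I) ZZ_nontriv.

Definition kZZ := palg ZZ_pres.
HB.instance Definition _ := GRing.Algebra.on kZZ.

(* The group element i of Z, seen in k[Z]. *)
Definition grp (i : int) : kZZ := pa_gen (D := ZZ_pres) i.

Lemma grpD i j : grp (i + j) = grp i * grp j.
Proof. by rewrite /grp pa_genM. Qed.
Lemma grp0 : grp 0 = 1.
Proof. by []. Qed.
End GroupAlgebra.

(* A direct sum decomposition M = (+)_i M_i is given by its projections pr i,
   so that M_i is the set of the x such that pr i x = x. *)
Record direct_sum (I : eqType) (M : zmodType) (pr : I -> M -> M) : Prop := {
  ds_add : forall i x y, pr i (x + y) = pr i x + pr i y;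
  ds_orth : forall i j x, pr i (pr j x) = if i == j then pr i x else 0;
  ds_sum : forall x, exists s : seq I, uniq s /\ x = \sum_(i <- s) pr i x
}.

Record connected_grading (k : fieldType) (A : algType k) := {
  gcomp : nat -> A -> A;
  gcomp_linear : forall m, linear (gcomp m);
  gcomp_sum : direct_sum gcomp;
  gcompM : forall i j a b, gcomp i a = a -> gcomp j b = b ->
    gcomp (i + j)%N (a * b) = a * b;
  gcomp01 : gcomp 0%N 1 = 1;
  gcomp0 : forall a, exists c : k, gcomp 0%N a == c%:A
}.

Definition in_deg (k : fieldType) (A : algType k) (G : connected_grading A)
  (m : nat) (a : A) : Prop := gcomp G m a = a.

Section TrivialModule.
Variables (k : fieldType) (A : algType k) (G : connected_grading A).

(* The augmentation A -> A_0 = k. *)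
Definition augm (a : A) : k := xchoose (gcomp0 G a).

Lemma augmE a : gcomp G 0 a = (augm a)%:A.
Proof. exact/eqP/(xchooseP (gcomp0 G a)). Qed.

Lemma in_alg_injective : injective (in_alg A).
Proof. exact: fmorph_inj. Qed.

Lemma gcompD m a b : gcomp G m (a + b) = gcomp G m a + gcomp G m b.
Proof. exact: (ds_add (gcomp_sum G)). Qed.

Lemma gcomp_zero m : gcomp G m 0 = 0.
Proof. by apply: (addrI (gcomp G m 0)); rewrite -gcompD !addr0. Qed.

Lemma gcomp_big m (I : Type) (s : seq I) (F : I -> A) :
  gcomp G m (\sum_(i <- s) F i) = \sum_(i <- s) gcomp G m (F i).
Proof. exact: (big_morph _ (gcompD m) (gcomp_zero m)). Qed.

Lemma in_deg_gcomp m a : in_deg G m (gcomp G m a).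
Proof. by rewrite /in_deg (ds_orth (gcomp_sum G)) eqxx. Qed.

Lemma augmD a b : augm (a + b) = augm a + augm b.
Proof.
by apply: in_alg_injective; rewrite rmorphD /= -!augmE gcompD.
Qed.
Lemma augm1 : augm 1 = 1.
Proof. by apply: in_alg_injective; rewrite /= -augmE gcomp01 scale1r. Qed.
Lemma augmM a b : augm (a * b) = augm a * augm b.
Proof.
apply: in_alg_injective; rewrite rmorphM /= -!augmE.
have orth := ds_orth (gcomp_sum G).
have hab i j : gcomp G 0 (gcomp G i a * gcomp G j b) =
    gcomp G 0 (gcomp G i a) * gcomp G 0 (gcomp G j b).
  have ij := gcompM (in_deg_gcomp i a) (in_deg_gcomp j b).
  rewrite -ij !orth; case: i j ij => [|i] [|j] ij /=; rewrite ?mul0r ?mulr0 //.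
have [s [_ ea]] := ds_sum (gcomp_sum G) a.
have [t [_ eb]] := ds_sum (gcomp_sum G) b.
rewrite [in LHS]ea [in LHS]eb [in RHS]ea [in RHS]eb.
rewrite !gcomp_big !mulr_suml gcomp_big; apply: eq_bigr => i _.
by rewrite !mulr_sumr gcomp_big; apply: eq_bigr => j _; rewrite hab.
Qed.

(* The trivial left module k and the trivial right module k; right A-modules
   are left modules over the opposite ring A^c. *)
Definition kleft (_ : connected_grading A) : Type := k.
Definition kright (_ : connected_grading A) : Type := k.
HB.instance Definition _ := GRing.Zmodule.copy (kleft G) k.
HB.instance Definition _ := GRing.Zmodule.copy (kright G) k.

Definition kleft_scale (a : A) (x : kleft G) : kleft G := augm a * x.
Fact kleft_scaleA a b v :
  kleft_scale a (kleft_scale b v) = kleft_scale (a * b) v.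
Proof. by rewrite /kleft_scale augmM mulrA. Qed.
Fact kleft_scale1 : left_id 1 kleft_scale.
Proof. by move=> v; rewrite /kleft_scale augm1 mul1r. Qed.
Fact kleft_scaleDr : right_distributive kleft_scale +%R.
Proof. by move=> a u v; rewrite /kleft_scale mulrDr. Qed.
Fact kleft_scaleDl v : {morph kleft_scale^~ v : a b / a + b}.
Proof. by move=> a b; rewrite /kleft_scale augmD mulrDl. Qed.
HB.instance Definition _ := GRing.Zmodule_isLmodule.Build A (kleft G)
  kleft_scaleA kleft_scale1 kleft_scaleDr kleft_scaleDl.

Definition kright_scale (a : A^c) (x : kright G) : kright G := augm a * x.
Fact kright_scaleA (a b : A^c) v :
  kright_scale a (kright_scale b v) = kright_scale (a * b) v.
Proof. by rewrite /kright_scale augmM mulrA [augm b * _]mulrC. Qed.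
Fact kright_scale1 : left_id 1 kright_scale.
Proof. by move=> v; rewrite /kright_scale augm1 mul1r. Qed.
Fact kright_scaleDr : right_distributive kright_scale +%R.
Proof. by move=> a u v; rewrite /kright_scale mulrDr. Qed.
Fact kright_scaleDl v : {morph kright_scale^~ v : a b / a + b}.
Proof. by move=> a b; rewrite /kright_scale augmD mulrDl. Qed.
HB.instance Definition _ := GRing.Zmodule_isLmodule.Build A^c (kright G)
  kright_scaleA kright_scale1 kright_scaleDr kright_scaleDl.
End TrivialModule.

Section Homological.
Variable R : nzRingType.

Definition projective (P : lmodType R) : Prop :=
  forall (M N : lmodType R) (f : {linear M -> N}) (g : {linear P -> N}),
    (forall y, exists x, f x = y) ->
    exists h : {linear P -> M}, forall x, f (h x) = g x.

Definition injective_module (Q : lmodType R) : Prop :=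
  forall (M N : lmodType R) (f : {linear M -> N}) (g : {linear M -> Q}),
    injective f ->
    exists h : {linear N -> Q}, forall x, h (f x) = g x.

(* An exact sequence ... -> C_1 -> C_0 -> M -> 0. *)
Record resolution (M : lmodType R) := Resolution {
  res_mod :> nat -> lmodType R;
  res_d : forall i, {linear res_mod i.+1 -> res_mod i};
  res_aug : {linear res_mod 0%N -> M};
  res_surj : forall y, exists x, res_aug x = y;
  res_exact0 : forall x, res_aug x = 0 <-> exists y, res_d 0%N y = x;
  res_exact : forall i x, res_d i x = 0 <-> exists y, res_d i.+1 y = x
}.

(* An exact sequence 0 -> M -> C^0 -> C^1 -> ... *)
Record coresolution (M : lmodType R) := Coresolution {
  cor_mod :> nat -> lmodType R;
  cor_d : forall i, {linear cor_mod i -> cor_mod i.+1};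
  cor_in : {linear M -> cor_mod 0%N};
  cor_inj : injective cor_in;
  cor_exact0 : forall x, cor_d 0%N x = 0 <-> exists y, cor_in y = x;
  cor_exact : forall i x, cor_d i.+1 x = 0 <-> exists y, cor_d i y = x
}.

Definition projective_resolution (M : lmodType R) (P : resolution M) : Prop :=
  forall i, projective (P i).

Definition projdim_le (M : lmodType R) (d : nat) : Prop :=
  exists P : resolution M, projective_resolution P /\
    forall i, (d < i)%N -> forall x : P i, x = 0.

Definition gldim_finite : Prop :=
  exists d, forall M : lmodType R, projdim_le M d.

Definition injdim_le (M : lmodType R) (d : nat) : Prop :=
  exists Q : coresolution M, (forall i, injective_module (Q i)) /\
    forall i, (d < i)%N -> forall x : Q i, x = 0.

Definition injdim_eq (M : lmodType R) (d : nat) : Prop :=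
  injdim_le M d /\ forall d', injdim_le M d' -> (d <= d')%N.

(* Ext^i_R(M, N) is the group of i-cocycles modulo i-coboundaries. *)
Section Ext.
Variables (M : lmodType R) (P : resolution M) (N : lmodType R).

Definition cocycle (i : nat) (f : P i -> N) : Prop :=
  linear f /\ forall x, f (res_d P i x) = 0.

Definition coboundary (i : nat) : (P i -> N) -> Prop :=
  match i with
  | 0 => fun f => forall x, f x = 0
  | j.+1 => fun f => exists h : {linear P j -> N},
              forall x, f x = h (res_d P j x)
  end.

Definition Ext_zero (i : nat) : Prop :=
  forall f : P i -> N, cocycle f -> coboundary f.

(* iota : k -> R is the structure map of the k-algebra R. *)
Definition Ext_dim1 (k : fieldType) (iota : k -> R) (i : nat) : Prop :=
  exists f : P i -> N, [/\ cocycle f, ~ coboundary f &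
    forall g : P i -> N, cocycle g ->
      exists c : k, coboundary (fun x => g x - iota c *: f x)].
End Ext.
End Homological.

(* As Ext does not depend on the projective resolution, its properties are
   required for all of them. *)
Definition Ext_concentrated (k : fieldType) (R : nzRingType) (iota : k -> R)
    (M N : lmodType R) (n : nat) : Prop :=
  forall P : resolution M, projective_resolution P ->
    Ext_dim1 P N iota n /\ forall i, i <> n -> Ext_zero P N i.

Record AS_regular (k : fieldType) (A : algType k) (G : connected_grading A)
    (n : nat) : Prop := {
  as_left : Ext_concentrated (in_alg A) (kleft G : lmodType A)
    (A^o : lmodType A)%type n;
  as_right : Ext_concentrated (in_alg A : k -> A^c)
    (kright G : lmodType A^c) ((A^c)^o : lmodType A^c)%type n;
  as_injdim : exists d, injdim_eq (A^o : lmodType A)%type d /\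
    injdim_eq ((A^c)^o : lmodType A^c)%type d;
  as_gldim : gldim_finite A
}.

Record graded_Zaction (k : fieldType) (A : algType k)
    (G : connected_grading A) := {
  za :> int -> {lrmorphism A -> A};
  za0 : forall a, za 0 a = a;
  zaD : forall i j a, za (i + j) a = za i (za j a);
  za_deg : forall i m a, in_deg G m a -> in_deg G m (za i a)
}.

Section Equivariant.
Variables (k : fieldType) (A : algType k) (G : connected_grading A).
Variable rho : graded_Zaction G.

(* A left A^e-module M is an A-bimodule, with a m b = tens a b *: m. *)
Record compatible_action (M : lmodType (Aenv A)) (act : int -> M -> M)
    : Prop := {
  ca0 : forall x, act 0 x = x;
  caD : forall i j x, act (i + j) x = act i (act j x);
  ca_add : forall i x y, act i (x + y) = act i x + act i y;
  ca_compat : forall i a b x,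
    act i (tens a b *: x) = tens (rho i a) (rho i b) *: act i x
}.

Definition equivariant (M N : lmodType (Aenv A)) (actM : int -> M -> M)
    (actN : int -> N -> N) (f : M -> N) : Prop :=
  forall i x, f (actM i x) = actN i (f x).

Definition equivariant_projective (P : lmodType (Aenv A))
    (actP : int -> P -> P) : Prop :=
  forall (M N : lmodType (Aenv A)) actM actN
         (f : {linear M -> N}) (g : {linear P -> N}),
    compatible_action actM -> compatible_action actN ->
    equivariant actM actN f -> equivariant actP actN g ->
    (forall y, exists x, f x = y) ->
    exists h : {linear P -> M},
      equivariant actP actM h /\ forall x, f (h x) = g x.

Record graded_bimodule (M : lmodType (Aenv A)) (deg : int -> M -> M)
    : Prop := {
  gb_sum : direct_sum deg;
  gb_deg : forall (i j : nat) (m : int) a b x,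
    in_deg G i a -> in_deg G j b -> deg m x = x ->
    deg (i%:Z + m + j%:Z) (tens a b *: x) = tens a b *: x
}.

Definition act_on_A (i : int) (x : Abim A) : Abim A := rho i x.

(* A projective resolution of A in the category of A-bimodules with a compatible
   action of Z. Its grading, preserved by all the structure maps, is what gives
   a meaning to the homogeneous elements of Ext. *)
Record equivariant_resolution := {
  er_res :> resolution (Abim A : lmodType (Aenv A));
  er_act : forall i, int -> er_res i -> er_res i;
  er_deg : forall i, int -> er_res i -> er_res i;
  er_act_compat : forall i, compatible_action (@er_act i);
  er_proj : forall i, equivariant_projective (@er_act i);
  er_d_act : forall i, equivariant (@er_act i.+1) (@er_act i) (res_d er_res i);
  er_aug_act : equivariant (@er_act 0%N) act_on_A (res_aug er_res);
  er_deg_gr : forall i, graded_bimodule (@er_deg i);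
  er_act_deg : forall i g m x,
    er_act g (er_deg m x) = er_deg m (er_act g x :> er_res i);
  er_d_deg : forall i m x,
    res_d er_res i (er_deg m x) = er_deg m (res_d er_res i x);
  er_aug_deg : forall (m : nat) x,
    gcomp G m (res_aug er_res x : A) = res_aug er_res (er_deg m%:Z x)
}.

Variables (P : equivariant_resolution) (n : nat).

(* Cochains in Hom_{A^e}(P_n, A^e) are linear for the outer bimodule structure
   of A^e, i.e. for left multiplication in the ring A^e; the two operations
   below come from the inner structure a (x (x) y) b = xb (x) ay, i.e. from
   right multiplication in A^e. *)
Definition cochain : Type := P n -> Aenv A.
Definition ext_cocycle (f : cochain) : Prop :=
  cocycle (P := P) (N := (Aenv A)^o%type) f.
Definition ext_eq (f g : cochain) : Prop :=
  coboundary (P := P) (N := (Aenv A)^o%type) (fun x => f x - g x).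

Definition lact (a : A) (f : cochain) : cochain := fun x => f x * tens 1 a.
Definition ract (f : cochain) (a : A) : cochain := fun x => f x * tens a 1.
Definition kact (c : k) (f : cochain) : cochain := fun x => c *: f x.

(* (g -> f)(p) = (g (x) g)(f (g^-1 p)) *)
Definition gact (g : int) (f : cochain) : cochain :=
  fun x => Aenv_map (rho g) (f (er_act (- g) x)).

Definition Aenv_in_deg (d : int) (t : Aenv A) : Prop :=
  exists s : seq (A * A), t = \sum_(p <- s) tens p.1 p.2 /\
    forall p, p \in s -> exists i j : nat,
      [/\ in_deg G i p.1, in_deg G j p.2 & i%:Z + j%:Z = d].

Definition ext_homogeneous (e : cochain) : Prop :=
  exists (d : int) (f : cochain),
    [/\ ext_cocycle f, ext_eq e f &
        forall m x, er_deg m x = x -> Aenv_in_deg (m + d) (f x)].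

(* e represents a homogeneous free generator of the left A-module
   Ext^n_{A^e}(A, A^e). *)
Record free_generator (e : cochain) : Prop := {
  fg_cocycle : ext_cocycle e;
  fg_homog : ext_homogeneous e;
  fg_gen : forall f, ext_cocycle f -> exists a, ext_eq f (lact a e);
  fg_free : forall a, ext_eq (lact a e) (fun=> 0) -> a = 0
}.

Definition Nakayama (e : cochain) (mu : A -> A) : Prop :=
  forall a, ext_eq (ract e a) (lact (mu a) e).

Definition homological_determinant (e : cochain)
    (hdet : {lrmorphism kZZ k -> k^o}) : Prop :=
  forall g : int, ext_eq (gact g e) (kact (hdet (grp k (- g))) e).
End Equivariant.

(* Main.v *)
Require Import Defs.
From HB Require Import structures.
From mathcomp Require Import all_boot all_order all_algebra.
From mathcomp Require Import boolp classical_sets functions.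
From mathcomp Require Import finmap monalg.

Set Implicit Arguments.
Unset Strict Implicit.
Unset Printing Implicit Defensive.

Import GRing.Theory.
Local Open Scope ring_scope.

(** Write [mu] for the Nakayama automorphism. The theorem is an instance of a
    general fact: on Hochschild homology with coefficients in [A] twisted by an
    automorphism [mu], that automorphism acts as the identity. A class of this
    homology is represented by a chain of a bimodule resolution closed up to a
    circle, that is, taken modulo the relations [a p = p mu(a)]; turning the
    chain once around the circle applies [mu] to it and does not change its
    class. Precisely, lift a cycle of the twisted coinvariants of a resolution
    [F] to its tensor square over [A]. The two augmentations of the tensor
    square onto [F] are homotopic; exchanging the two factors, with [mu] applied
    to the one that crosses the cut of the circle, exchanges the two
    augmentations and applies [mu] to one of them ([rotation],
    [twisted_cycle_invariant]).

    By the relation [e a = mu(a) e], the cocycle [e] followed by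
    [u \otimes v |-> v mu(u)] takes the same value on homologous twisted
    cycles. If a twisted cycle on which this value is 1 exists, the action of
    [mu] multiplies the value by the homological determinant on the one hand,
    and preserves it on the other hand, and the theorem follows
    ([hdet_of_action]).

    That cycle is the dual basis element of Van den Bergh duality. Take for [F]
    a minimal graded free bimodule resolution of [A]; it exists by the graded
    Nakayama lemma ([minimal_free_resolution_exists]). Since [A] and the terms
    of [F] are projective as right modules, [F] is contractible over [A] on
    the right ([contraction]), so that tensoring with the trivial module gives
    a minimal resolution of the latter ([base_change_resolution]). Finite global
    dimension makes this resolution bounded, and the condition on Ext of the
    trivial module forces its last term to be free on one generator [x], in
    degree [n] ([last_generator]). The coefficient function of [x] is a
    cocycle on [F], hence cohomologous to [a e] for some [a]. Then [x a] is
    the cycle: if [t] is a coefficient of the differential of [x], the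
    coefficient function multiplied by [t] is a coboundary, and the
    Nakayama relation and the freeness of Ext over [A] turn this into the cycle
    condition ([last_twisted_cycle]); comparing [e] with its own expansion in
    terms of the coefficient function shows that its value on [x a] is 1
    ([last_class]).

    The given resolution is compared with [F] by maps of complexes and
    homotopies; it consists of projective bimodules because forgetting a
    compatible action has a right adjoint that preserves surjections
    ([equivariant_projective_projective]). *)

(** * Additive maps and free modules *)

Section AdditiveMaps.
Variables (U V : zmodType) (f : U -> V).
Hypothesis fD : {morph f : x y / x + y}.

Lemma morphD0 : f 0 = 0.
Proof. by apply: (addrI (f 0)); rewrite -fD !addr0. Qed.

Lemma morphDN : {morph f : x / - x}.
Proof. by move=> x; apply: (addrI (f x)); rewrite -fD !subrr morphD0. Qed.

Lemma morphDB : {morph f : x y / x - y}.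
Proof. by move=> x y; rewrite fD morphDN. Qed.

Lemma morphD_sum (I : Type) (r : seq I) (P : pred I) (F : I -> U) :
  f (\sum_(i <- r | P i) F i) = \sum_(i <- r | P i) f (F i).
Proof. exact: (big_morph f fD morphD0). Qed.
End AdditiveMaps.

Lemma morphD_comp (U V W : zmodType) (f : V -> W) (g : U -> V) :
  {morph f : x y / x + y} -> {morph g : x y / x + y} ->
  {morph (fun x => f (g x)) : x y / x + y}.
Proof. by move=> fD gD x y; rewrite gD fD. Qed.

Lemma morphD_add (U V : zmodType) (f g : U -> V) :
  {morph f : x y / x + y} -> {morph g : x y / x + y} ->
  {morph (fun x => f x + g x) : x y / x + y}.
Proof. by move=> fD gD x y; rewrite gD fD addrACA. Qed.

Lemma morphD_sub (U V : zmodType) (f g : U -> V) :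
  {morph f : x y / x + y} -> {morph g : x y / x + y} ->
  {morph (fun x => f x - g x) : x y / x + y}.
Proof. by move=> fD gD x y; rewrite gD fD opprD addrACA. Qed.

Lemma morphD_cst0 (U V : zmodType) : {morph (fun _ : U => 0 : V) : x y / x + y}.
Proof. by move=> x y; rewrite addr0. Qed.

Lemma scale_morphD (R : nzRingType) (M : lmodType R) (t : R) :
  {morph ( *:%R t : M -> M) : x y / x + y}.
Proof. exact: scalerDr. Qed.

Lemma linear_morphD (R : nzRingType) (U V : lmodType R) (f : {linear U -> V}) :
  {morph f : x y / x + y}.
Proof. exact: linearD. Qed.

Lemma linear_of (R : nzRingType) (U V : lmodType R) (f : U -> V) :
  linear f -> exists g : {linear U -> V}, forall x, g x = f x.
Proof.
move=> fL; pose m := GRing.isLinear.Build R U V _ f fL.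
by exists (HB.pack_for {linear U -> V} f m).
Qed.

Lemma linear_sub (R : nzRingType) (U V : lmodType R) (f g : {linear U -> V}) :
  exists h : {linear U -> V}, forall x, h x = f x - g x.
Proof.
apply: linear_of => c x y; rewrite (linearP f) (linearP g) opprD addrACA.
by rewrite scalerBr.
Qed.

Section FreeModules.
Variables (X : choiceType) (G N : zmodType).
Implicit Types (f : {malg G[X]}) (T : X -> G -> N).

(** The finitely supported families of elements of [G] are the direct sum of
    copies of [G]; [mlift T] is the map out of it that is [T x] on the
    summand of index [x]. *)
Definition mlift T f : N := \sum_(x <- msupp f) T x f@_x.

Lemma mlift_w T f (D : {fset X}) :
  (forall x, T x 0 = 0) -> (forall x, x \in msupp f -> x \in D) ->
  mlift T f = \sum_(x <- D) T x f@_x.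
Proof.
move=> T0 sfD; rewrite /mlift; apply: big_fset_incl.
  exact/fsubsetP.
by move=> x _ /mcoeff_outdom ->.
Qed.

Lemma mliftU T x g : (forall x, T x 0 = 0) -> mlift T << g *g x >> = T x g.
Proof.
move=> T0; rewrite (mlift_w (D := [fset x]%fset)) //.
  by rewrite big_seq_fset1 mcoeffUU.
by apply/fsubsetP/msuppU_le.
Qed.

Lemma mliftD T : (forall x, {morph T x : g h / g + h}) ->
  {morph mlift T : f g / f + g}.
Proof.
move=> TD f g; have T0 x : T x 0 = 0 by exact: (morphD0 (TD x)).
pose D := (msupp f `|` msupp g)%fset.
rewrite !(mlift_w (D := D)) //; first 1 last.
- by move=> x xg; rewrite in_fsetU xg orbT.
- by move=> x xf; rewrite in_fsetU xf.
- by apply/fsubsetP; exact: msuppD_le.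
by rewrite -big_split; apply: eq_bigr => x _; rewrite mcoeffD TD.
Qed.

Lemma malg_ind (Q : {malg G[X]} -> Prop) :
  Q 0 -> (forall f g, Q f -> Q g -> Q (f + g)) ->
  (forall x g, Q << g *g x >>) -> forall f, Q f.
Proof.
move=> Q0 QD QU f; rewrite [f]monalgE.
by elim/big_rec: _ => // x g _; apply: QD.
Qed.

Lemma malg_morph_eq (u v : {malg G[X]} -> N) :
  {morph u : f g / f + g} -> {morph v : f g / f + g} ->
  (forall x g, u << g *g x >> = v << g *g x >>) -> u =1 v.
Proof.
move=> uD vD uv; elim/malg_ind => [|f g uf ug|//].
  by rewrite (morphD0 uD) (morphD0 vD).
by rewrite uD vD uf ug.
Qed.
End FreeModules.

Section FreeLinear.
Variables (R : nzRingType) (X : choiceType) (N : lmodType R).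

Definition gen (x : X) : {malg R[X]} := << 1 *g x >>.

Lemma scale_gen r x : r *: gen x = << r *g x >>.
Proof.
by apply/malgP => y; rewrite mcoeffZ !mcoeffU mulrnAr mulr1.
Qed.

Lemma malg_gens (f : {malg R[X]}) : f = \sum_(x <- msupp f) f@_x *: gen x.
Proof. by rewrite {1}[f]monalgE; apply: eq_bigr => x _; rewrite scale_gen. Qed.

Definition free_lift (v : X -> N) : {malg R[X]} -> N :=
  mlift (fun x r => r *: v x).

Fact free_lift_morphD v : {morph free_lift v : f g / f + g}.
Proof. by apply: mliftD => x g h; rewrite scalerDl. Qed.

Fact free_lift_linear v : linear (free_lift v).
Proof.
move=> r f g; rewrite free_lift_morphD; congr (_ + _).
elim/malg_ind: f => [|f1 f2 h1 h2|x s].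
- by rewrite scaler0 (morphD0 (free_lift_morphD v)) scaler0.
- by rewrite scalerDr !free_lift_morphD scalerDr h1 h2.
rewrite -scale_gen scalerA !scale_gen /free_lift !mliftU ?scalerA //.
  by move=> y; rewrite scale0r.
by move=> y; rewrite scale0r.
Qed.

HB.instance Definition _ v :=
  GRing.isLinear.Build R {malg R[X]} N _ (free_lift v) (free_lift_linear v).

Lemma free_liftZ v r f : free_lift v (r *: f) = r *: free_lift v f.
Proof. exact: linearZ. Qed.

Lemma free_lift_gen v x : free_lift v (gen x) = v x.
Proof. by rewrite /free_lift mliftU ?scale1r // => y; rewrite scale0r. Qed.

Lemma free_linear_eq (f g : {linear {malg R[X]} -> N}) :
  (forall x, f (gen x) = g (gen x)) -> f =1 g.
Proof.
move=> fg; apply: malg_morph_eq => [||x r]; try exact: linearD.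
by rewrite -scale_gen !linearZ /= fg.
Qed.
End FreeLinear.

Lemma free_projective (R : nzRingType) (X : choiceType) :
  projective {malg R[X]}.
Proof.
move=> M N f g f_surj.
have /choice [h hP] : forall x : X, exists m, f m = g (gen R x).
  by move=> x; apply: f_surj.
exists (free_lift h) => p.
rewrite -[LHS]/((f \o free_lift h) p); apply: free_linear_eq => x.
by rewrite /= free_lift_gen hP.
Qed.

Section Basis.
Variables (k : fieldType) (R : algType k) (V : lmodType R).

Definition kcomb : {malg k[V]} -> V := mlift (fun v c => c%:A *: v).

Lemma kcombD : {morph kcomb : f g / f + g}.
Proof. by apply: mliftD => v c d; rewrite scalerDl scalerDl. Qed.

Lemma kcombU v c : kcomb << c *g v >> = c%:A *: v.
Proof. by rewrite /kcomb mliftU // => u; rewrite scale0r scale0r. Qed.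

Variables (S W : V -> Prop).
Hypotheses (W0 : W 0) (WZ : forall (c : k) v, W v -> W (c%:A *: v)).

Lemma kcombZ (c : k) f : kcomb (c *: f) = c%:A *: kcomb f.
Proof.
elim/malg_ind: f => [|f g hf hg|v d].
- by rewrite scaler0 (morphD0 kcombD) scaler0.
- by rewrite scalerDr !kcombD hf hg scalerDr.
rewrite -scale_gen scalerA !scale_gen !kcombU scalerA -scalerAl mul1r.
by rewrite scalerA.
Qed.

Definition supported (X : V -> Prop) (f : {malg k[V]}) :=
  forall v, v \in msupp f -> X v.

(** By Zorn's lemma: a maximal family in [S] that is linearly independent modulo
    [W] spans. With [W = 0] this gives a basis of [A] over [k], with [W = m K]
    minimal generators of [K]. *)
Lemma basis_mod : exists X : V -> Prop,
  [/\ forall v, X v -> S v,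
      forall f, supported X f -> W (kcomb f) -> f = 0 &
      forall v, S v -> exists2 f, supported X f & W (v - kcomb f)].
Proof.
pose P (X : set V) := (forall v, X v -> S v) /\
  (forall f, supported X f -> W (kcomb f) -> f = 0).
have [F FP Ftot|X [[XS Xind] Xmax]] := @Zorn_bigcup V P.
  split=> [v [X FX Xv]|f fF Wf]; first exact: (FP X FX).1.
  have [//|[X FX fX]] : f = 0 \/ exists2 X, F X & supported X f; last first.
    exact: (FP X FX).2.
  have [->|nzf] := eqVneq f 0; first by left.
  right; have : msupp f != fset0.
    apply: contra nzf => /eqP f0; rewrite [f]monalgE f0.
    by rewrite big_seq_fset0.
  move=> nz.
  have main : forall s : seq V, (forall v, v \in s -> (\bigcup_(X in F) X)%classic v) ->
      s != [::] -> exists2 X, F X & forall v, v \in s -> X v.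
    elim=> // v s IH vs _.
    have [X FX Xv] := vs v (mem_head _ _).
    have [s0|snz] := eqVneq s [::].
      by exists X => // u; rewrite s0 inE => /eqP ->.
    have [|Y FY sY] := IH _ snz.
      by move=> u us; apply: vs; rewrite inE us orbT.
    have [XY|YX] := Ftot X Y FX FY.
      by exists Y => // u; rewrite inE => /orP [/eqP ->|/sY //]; apply: XY.
    by exists X => // u; rewrite inE => /orP [/eqP ->|/sY /YX].
  have [|X FX fX] := main (enum_fset (msupp f)) fF.
    apply: contra nz => /eqP f0; apply/eqP/fsetP => v; rewrite in_fset0.
    by have : v \in enum_fset (msupp f) = false by rewrite f0.
  by exists X.
exists X; split=> // v Sv; apply: contrapT => nspan.
pose Y : set V := (fun u => X u \/ u = v).
apply: (Xmax Y); first split.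
- by move=> u; left.
- move=> /(_ v) YX; apply: nspan; exists << 1 *g v >>.
    move=> u /(fsubsetP msuppU_le); rewrite inE => /eqP ->.
    by apply: YX; right.
  by rewrite kcombU scale1r scale1r subrr.
split=> [u [/XS|->]|f fY Wf] //.
pose c := f@_v; pose f' := f - << c *g v >>.
have f'X : supported X f'.
  move=> u; rewrite -mcoeff_neq0 mcoeffB mcoeffU.
  have [<-|uv] := eqVneq v u; first by rewrite subrr eqxx.
  rewrite mulr0n subr0 mcoeff_neq0 => /fY [//|uv'].
  by rewrite uv' eqxx in uv.
have ff' : f = << c *g v >> + f' by rewrite addrC subrK.
have [c0|cn0] := eqVneq c 0.
  by apply: (Xind f) => // u; move: (f'X u); rewrite /f' c0 monalgU0 subr0.
case: nspan; exists (- c^-1 *: f') => [u|].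
  by move/(fsubsetP (msuppZ_le _ _)); apply: f'X.
rewrite kcombZ scaleNr scaleNr opprK.
have -> : v + c^-1%:A *: kcomb f' = c^-1%:A *: kcomb f.
  rewrite ff' kcombD kcombU scalerDr scalerA -scalerAl mul1r scalerA.
  by rewrite mulVf // scale1r scale1r.
exact: WZ.
Qed.
End Basis.

(** * The enveloping algebra and its grading *)

Section EnvelopingLifts.
Variables (k : fieldType) (A : algType k).
Local Notation Ae := (Aenv A).

Lemma tensDl a a' b : tens (a + a') b = tens a b + tens a' b :> Ae.
Proof. by have := (@tens_bilinear k A).1 b 1 a a'; rewrite !scale1r. Qed.

Lemma tensDr a b b' : tens a (b + b') = tens a b + tens a b' :> Ae.
Proof. by have := (@tens_bilinear k A).2 a 1 b b'; rewrite !scale1r. Qed.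

Lemma tens0l b : tens 0 b = 0 :> Ae.
Proof. exact: (morphD0 (fun a a' => tensDl a a' b)). Qed.

Lemma tens0r a : tens a 0 = 0 :> Ae.
Proof. exact: (morphD0 (tensDr a)). Qed.

Lemma tensZl (c : k) a b : tens (c *: a) b = c *: tens a b :> Ae.
Proof.
by have := (@tens_bilinear k A).1 b c a 0; rewrite /= addr0 tens0l addr0.
Qed.

Lemma tensZr (c : k) a b : tens a (c *: b) = c *: tens a b :> Ae.
Proof.
by have := (@tens_bilinear k A).2 a c b 0; rewrite /= addr0 tens0r addr0.
Qed.

Lemma tens11 : tens 1 1 = 1 :> Ae. Proof. by []. Qed.

Lemma tensE a b : tens a b = tens a 1 * tens 1 b :> Ae.
Proof. by rewrite tensM mulr1 mulr1. Qed.

Lemma tensE' a b : tens a b = tens 1 b * tens a 1 :> Ae.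
Proof. by rewrite tensM mul1r mul1r. Qed.

Lemma tens_comm a b : tens a 1 * tens 1 b = tens 1 b * tens a 1 :> Ae.
Proof. by rewrite -tensE tensE'. Qed.

Lemma Aenv_ind (Q : Ae -> Prop) :
  Q 0 -> (forall t u, Q t -> Q u -> Q (t + u)) ->
  (forall a b, Q (tens a b)) -> forall t, Q t.
Proof.
move=> Q0 QD Qt t.
have -> : t = \sum_(p <- repr t) p.1 *: tens p.2.1 p.2.2.
  apply: pa_liftP => W f tf.
  have fD : {morph pa_lift f : x y / x + y} := pa_liftD tf.
  rewrite (morphD_sum fD) /= {1}/pa_lift /pa_eval; apply: eq_bigr => p _.
  by rewrite pa_liftZ // pa_lift_gen //; case: (p.2).
by elim/big_rec: _ => // p u _; apply: QD; rewrite -tensZl.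
Qed.

Lemma Aenv_morph_eq (V : zmodType) (f g : Ae -> V) :
  {morph f : x y / x + y} -> {morph g : x y / x + y} ->
  (forall a b, f (tens a b) = g (tens a b)) -> f =1 g.
Proof.
move=> fD gD fg; elim/Aenv_ind => [|t u ft fu|//].
  by rewrite (morphD0 fD) (morphD0 gD).
by rewrite fD gD ft fu.
Qed.

Lemma bimodule_eq (Y : choiceType) (V : zmodType) (f g : {malg Ae[Y]} -> V) :
  {morph f : p q / p + q} -> {morph g : p q / p + q} ->
  (forall u v y, f << tens u v *g y >> = g << tens u v *g y >>) -> f =1 g.
Proof.
move=> fD gD fg; apply: malg_morph_eq => // y; apply: Aenv_morph_eq => [t u|t u|//].
  by rewrite monalgUD fD.
by rewrite monalgUD gD.
Qed.

Section Lift.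
Variables (N : lmodType k) (f : A -> A -> N).
Hypothesis f_bilinear :
  (forall b, linear (f^~ b)) /\ (forall a, linear (f a)).

Definition elift (t : Ae) : N := pa_lift (D := env_pres A) (fun p => f p.1 p.2) t.

Let f_test : ap_test (a := env_pres A) (fun p => f p.1 p.2).
Proof. by split; [apply: f_bilinear.1 | apply: f_bilinear.2]. Qed.

Lemma elift_tens a b : elift (tens a b) = f a b.
Proof. exact: (pa_lift_gen f_test (a, b)). Qed.

Lemma eliftD : {morph elift : t u / t + u}.
Proof. exact: (pa_liftD f_test). Qed.

Lemma eliftZ (c : k) t : elift (c *: t) = c *: elift t.
Proof. exact: (pa_liftZ f_test). Qed.
End Lift.

(** A bimodule as a [k]-module, so that it can be the target of a map defined
    on the pure tensors of [A^e]. *)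
Definition kmod (M : lmodType Ae) : Type := M.
HB.instance Definition _ (M : lmodType Ae) := GRing.Zmodule.on (kmod M).

Section Restriction.
Variable M : lmodType Ae.
Definition kmod_scale (c : k) (v : kmod M) : kmod M := c%:A *: (v : M).
Fact kmod_scaleA a b v :
  kmod_scale a (kmod_scale b v) = kmod_scale (a * b) v.
Proof. by rewrite /kmod_scale scalerA -scalerAl mul1r scalerA. Qed.
Fact kmod_scale1 : left_id 1 kmod_scale.
Proof. by move=> v; rewrite /kmod_scale scale1r scale1r. Qed.
Fact kmod_scaleDr : right_distributive kmod_scale +%R.
Proof. by move=> a u v; rewrite /kmod_scale scalerDr. Qed.
Fact kmod_scaleDl v : {morph kmod_scale^~ v : a b / a + b}.
Proof. by move=> a b; rewrite /kmod_scale scalerDl scalerDl. Qed.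
HB.instance Definition _ := GRing.Zmodule_isLmodule.Build k (kmod M)
  kmod_scaleA kmod_scale1 kmod_scaleDr kmod_scaleDl.

Lemma kmodE (c : k) (v : kmod M) : c *: v = c%:A *: (v : M).
Proof. by []. Qed.
End Restriction.
End EnvelopingLifts.

Section GradingTheory.
Variables (k : fieldType) (R : algType k) (G : connected_grading R).

Lemma gcomp_gcomp i j a :
  gcomp G i (gcomp G j a) = if i == j then gcomp G i a else 0.
Proof. exact: (ds_orth (gcomp_sum G)). Qed.

Lemma gcomp_finite a :
  exists N, forall N', (N <= N')%N -> a = \sum_(i < N') gcomp G i a.
Proof.
have [s [us ea]] := ds_sum (gcomp_sum G) a.
exists (\max_(i <- s) i.+1) => N' le_sN.
rewrite {1}ea -(big_mkord xpredT (fun i => gcomp G i a)).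
rewrite [RHS](bigID [pred i | i \in s]) /= [X in _ = _ + X]big1 ?addr0.
  rewrite -[RHS]big_filter; apply: perm_big; apply: uniq_perm => //.
    by apply: filter_uniq; apply: iota_uniq.
  move=> i; rewrite mem_filter mem_index_iota /=.
  case is_: (i \in s) => //=; symmetry; apply: leq_trans le_sN.
  by rewrite (big_rem i) //= leq_max leqnn.
move=> i nis; rewrite ea gcomp_big big1_seq // => j /andP [_ js].
rewrite gcomp_gcomp; case: eqP => // ij; by rewrite ij js in nis.
Qed.

Lemma gcomp_deg i j a : in_deg G i a -> gcomp G j a = if j == i then a else 0.
Proof. by move=> ai; rewrite -{1}ai gcomp_gcomp; case: eqP => // ->. Qed.

Lemma homog_ind (Q : R -> Prop) :
  Q 0 -> (forall a b, Q a -> Q b -> Q (a + b)) ->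
  (forall i a, in_deg G i a -> Q a) -> forall a, Q a.
Proof.
move=> Q0 QD Qh a; have [N /(_ N (leqnn N)) ->] := gcomp_finite a.
elim/big_rec: _ => // i b _; apply: QD; apply: (Qh i); exact: in_deg_gcomp.
Qed.

Lemma gcompMl i a b j : in_deg G i a -> gcomp G (i + j) (a * b) = a * gcomp G j b.
Proof.
move=> ai; move: b; apply: homog_ind => [|b c hb hc|l b bl].
- by rewrite mulr0 !gcomp_zero mulr0.
- by rewrite mulrDr !gcompD mulrDr hb hc.
rewrite (gcomp_deg j bl) (gcomp_deg _ (gcompM ai bl)) eqn_add2l.
by case: eqP => //; rewrite mulr0.
Qed.

Lemma gcompMl0 i a b m : in_deg G i a -> (m < i)%N -> gcomp G m (a * b) = 0.
Proof.
move=> ai mi; move: b; apply: homog_ind => [|b c hb hc|l b bl].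
- by rewrite mulr0 gcomp_zero.
- by rewrite mulrDr gcompD hb hc addr0.
rewrite (gcomp_deg _ (gcompM ai bl)); case: eqP => // mE.
by rewrite mE ltnNge leq_addr in mi.
Qed.

Lemma augmN a : augm G (- a) = - augm G a.
Proof. exact: (morphDN (@augmD _ _ G)). Qed.

Lemma augmB a b : augm G (a - b) = augm G a - augm G b.
Proof. by rewrite augmD augmN. Qed.

Lemma augm_in_alg (c : k) : augm G c%:A = c.
Proof.
apply: (@in_alg_injective k R); rewrite /= -augmE.
have ZL := gcomp_linear G 0 c 1 0.
by rewrite addr0 gcomp_zero addr0 in ZL; rewrite ZL gcomp01.
Qed.

Lemma augmZ (c : k) a : augm G (c *: a) = c * augm G a.
Proof. by rewrite -[a in LHS]mul1r scalerAl augmM augm_in_alg. Qed.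

End GradingTheory.

Section EnvelopingGrading.
Variables (k : fieldType) (A : algType k) (G : connected_grading A).
Local Notation Ae := (Aenv A).

(** The total degree of the tensor product. *)
Definition env_comp (m : nat) : Ae -> Ae :=
  elift (fun a b => \sum_(i < m.+1) tens (gcomp G i a) (gcomp G (m - i) b)).

Let env_comp_bil m :
  (forall b, linear (fun a : A =>
     \sum_(i < m.+1) tens (gcomp G i a) (gcomp G (m - i) b) : Ae)) /\
  (forall a, linear (fun b : A =>
     \sum_(i < m.+1) tens (gcomp G i a) (gcomp G (m - i) b) : Ae)).
Proof.
split=> [b c a a'|a c b b']; rewrite scaler_sumr -big_split; apply: eq_bigr => i _.
  by rewrite (gcomp_linear G) tensDl tensZl.
by rewrite (gcomp_linear G) tensDr tensZr.
Qed.

Lemma env_compD m : {morph env_comp m : t u / t + u}.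
Proof. exact: eliftD. Qed.

Lemma env_compZ m (c : k) t : env_comp m (c *: t) = c *: env_comp m t.
Proof. exact: eliftZ. Qed.

Lemma env_comp_homog m i j a b : in_deg G i a -> in_deg G j b ->
  env_comp m (tens a b) = if m == (i + j)%N then tens a b else 0.
Proof.
move=> ai bj; rewrite /env_comp elift_tens //.
under eq_bigr do rewrite (gcomp_deg _ ai) (gcomp_deg _ bj).
case: eqP => [->|nm].
  have lt_i : (i < (i + j).+1)%N by rewrite ltnS leq_addr.
  rewrite (bigD1 (Ordinal lt_i)) //= eqxx addKn eqxx big1 ?addr0 // => l nl.
  by rewrite -val_eqE /= in nl; rewrite (negbTE nl) tens0l.
rewrite big1 // => l _; case: eqP => [li|]; last by rewrite tens0l.
case: eqP => [ml|]; last by rewrite tens0r.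
by case: nm; rewrite -ml -li subnKC // -ltnS.
Qed.

Lemma env_homog_ind (Q : Ae -> Prop) :
  Q 0 -> (forall t u, Q t -> Q u -> Q (t + u)) ->
  (forall i j a b, in_deg G i a -> in_deg G j b -> Q (tens a b)) ->
  forall t, Q t.
Proof.
move=> Q0 QD Qh; apply: Aenv_ind => // a b.
move: a; apply: (homog_ind (G := G)) => [|a a' ha ha'|i a ai].
- by rewrite tens0l.
- by rewrite tensDl; apply: QD.
move: b; apply: (homog_ind (G := G)) => [|b b' hb hb'|j b bj].
- by rewrite tens0r.
- by rewrite tensDr; apply: QD.
exact: (Qh i j).
Qed.

Fact env_comp_linear m : linear (env_comp m).
Proof. by move=> c t u; rewrite env_compD env_compZ. Qed.

Fact env_comp_sum : direct_sum env_comp.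
Proof.
split; first exact: env_compD.
  move=> m l; apply: env_homog_ind => [|t u ht hu|i j a b ai bj].
  - by rewrite !(morphD0 (env_compD _)) if_same.
  - by rewrite !env_compD ht hu; case: eqP; rewrite ?addr0.
  rewrite (env_comp_homog l ai bj); case: (l =P (i + j)%N) => [->|nl].
    by rewrite (env_comp_homog m ai bj); case: eqP.
  rewrite (morphD0 (env_compD _)) (env_comp_homog m ai bj).
  by case: eqP => // ml; case: eqP => // mij; case: nl; rewrite -ml -mij.
move=> t; suff [N tN] : exists N, forall N', (N <= N')%N ->
    t = \sum_(0 <= i < N') env_comp i t.
  by exists (index_iota 0 N); split; [apply: iota_uniq | apply: tN].
move: t; apply: env_homog_ind => [|t u [N1 h1] [N2 h2]|i j a b ai bj].
- by exists 0%N => N _; rewrite big1 // => i _; rewrite (morphD0 (env_compD _)).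
- exists (maxn N1 N2) => N; rewrite geq_max => /andP [/h1 e1 /h2 e2].
  by under eq_bigr do rewrite env_compD; rewrite big_split /= -e1 -e2.
exists (i + j).+1 => N ltN.
under eq_bigr do rewrite (env_comp_homog _ ai bj).
rewrite big_mkord (bigD1 (Ordinal ltN)) //= eqxx big1 ?addr0 // => l nl.
by rewrite -val_eqE /= in nl; rewrite (negbTE nl).
Qed.

Fact env_compM i j t u : env_comp i t = t -> env_comp j u = u ->
  env_comp (i + j)%N (t * u) = t * u.
Proof.
move=> <- <-; move: t u; apply: env_homog_ind => [|t t' ht ht'|p q a b ap bq] u.
- by rewrite !(morphD0 (env_compD _)) mul0r (morphD0 (env_compD _)).
- by rewrite env_compD mulrDl env_compD ht ht'.
move: u; apply: env_homog_ind => [|u u' hu hu'|r s c d cr ds].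
- by rewrite !(morphD0 (env_compD _)) mulr0 (morphD0 (env_compD _)).
- by rewrite env_compD mulrDr env_compD hu hu'.
rewrite (env_comp_homog _ ap bq) (env_comp_homog _ cr ds).
case: (i =P (p + q)%N) => [->|_]; last by rewrite mul0r (morphD0 (env_compD _)).
case: (j =P (r + s)%N) => [->|_]; last by rewrite mulr0 (morphD0 (env_compD _)).
rewrite tensM (env_comp_homog _ (gcompM ap cr) (gcompM ds bq)).
by rewrite -!addnA [(s + q)%N]addnC [(q + (r + s))%N]addnCA eqxx.
Qed.

Fact env_comp01 : env_comp 0 1 = 1.
Proof. exact: (env_comp_homog 0 (gcomp01 G) (gcomp01 G)). Qed.

Lemma env_comp0_tens a b :
  env_comp 0 (tens a b) = (augm G a * augm G b)%:A.
Proof.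
rewrite /env_comp elift_tens // big_ord1 subnn !augmE tensZl tensZr tens11.
by rewrite scalerA.
Qed.

Fact env_comp0 t : exists c : k, env_comp 0 t == c%:A.
Proof.
elim/Aenv_ind: t => [|t u [c /eqP hc] [d /eqP hd]|a b].
- by exists 0; rewrite (morphD0 (env_compD _)) scale0r.
- by exists (c + d); rewrite env_compD hc hd scalerDl.
by exists (augm G a * augm G b); rewrite env_comp0_tens.
Qed.

Definition env_grading : connected_grading Ae := Build_connected_grading
  env_comp_linear env_comp_sum env_compM env_comp01 env_comp0.

Lemma augm_tens a b : augm env_grading (tens a b) = augm G a * augm G b.
Proof.
by apply: (@in_alg_injective k Ae); rewrite /= -augmE /= env_comp0_tens.
Qed.
End EnvelopingGrading.

#[global] Opaque tens.

(** * Minimal graded free resolutions *)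

Section GradedModules.
Variables (k : fieldType) (R : algType k) (G : connected_grading R).

Record grmod := GrMod {
  gm_mod :> lmodType R;
  gpr : nat -> gm_mod -> gm_mod;
  gprD : forall i, {morph gpr i : x y / x + y};
  gpr_gpr : forall i j x, gpr i (gpr j x) = if i == j then gpr i x else 0;
  gpr_sum : forall x, exists N, x = \sum_(i < N) gpr i x;
  gprZ : forall i j a x, in_deg G i a -> gpr (i + j) (a *: x) = a *: gpr j x;
  gprZ0 : forall i m a x, in_deg G i a -> (m < i)%N -> gpr m (a *: x) = 0
}.

Record graded_sub (M : grmod) (K : M -> Prop) : Prop := {
  gs0 : K 0;
  gsD : forall x y, K x -> K y -> K (x + y);
  gsZ : forall a x, K x -> K (a *: x);
  gs_gpr : forall i x, K x -> K (gpr i x)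
}.

Definition homogeneous (M : grmod) (x : M) := exists i, gpr i x = x.

Lemma gpr0 (M : grmod) i : gpr i (0 : M) = 0.
Proof. exact: (morphD0 (gprD i)). Qed.

(** The submodule [m K], where [m] is the augmentation ideal. *)
Definition aug_mul (M : lmodType R) (K : M -> Prop) (v : M) :=
  exists s : seq (R * M), (forall p, p \in s -> augm G p.1 = 0 /\ K p.2) /\
    v = \sum_(p <- s) p.1 *: p.2.

Lemma aug_mul0 (M : lmodType R) (K : M -> Prop) : aug_mul K 0.
Proof. by exists [::]; split=> //; rewrite big_nil. Qed.

Lemma aug_mulD (M : lmodType R) (K : M -> Prop) u v :
  aug_mul K u -> aug_mul K v -> aug_mul K (u + v).
Proof.
move=> [s [sK ->]] [t [tK ->]]; exists (s ++ t); split.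
  by move=> p; rewrite mem_cat => /orP [/sK|/tK].
by rewrite big_cat.
Qed.

Lemma aug_mulZ (M : lmodType R) (K : M -> Prop) a v :
  aug_mul K v -> aug_mul K (a *: v).
Proof.
move=> [s [sK ->]]; exists [seq (a * p.1, p.2) | p <- s]; split.
  by move=> _ /mapP [p /sK [p1 p2] ->]; rewrite /= augmM p1 mulr0.
rewrite big_map scaler_sumr; apply: eq_bigr => p _; by rewrite scalerA.
Qed.

Lemma aug_mul1 (M : lmodType R) (K : M -> Prop) a v :
  augm G a = 0 -> K v -> aug_mul K (a *: v).
Proof.
move=> a0 Kv; exists [:: (a, v)]; split; last by rewrite big_seq1.
by move=> p; rewrite inE => /eqP ->.
Qed.

Definition subset_type (M : choiceType) (X : M -> Prop) : choiceType :=
  {x : M | `[< X x >]}.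

Lemma subset_typeP (M : choiceType) (X : M -> Prop) (x : subset_type X) :
  X (val x).
Proof. exact/asboolP/(valP x). Qed.

Definition incl (M : lmodType R) (X : M -> Prop) (x : subset_type X) : M := val x.

Section Generators.
Variables (M : grmod) (K : M -> Prop).
Hypothesis KG : graded_sub K.

(** The graded Nakayama lemma: a family of homogeneous elements spanning [K]
    modulo [m K] generates [K], because a homogeneous element of [m K] only
    involves elements of [K] of smaller degree. *)
Lemma graded_nakayama (I : M -> Prop) :
  I 0 -> (forall u v, I u -> I v -> I (u + v)) ->
  (forall a u, I u -> I (a *: u)) ->
  (forall v, K v -> homogeneous v -> exists u w,
     [/\ v = u + w, forall i, I (gpr i u) & aug_mul K w]) ->
  forall v, K v -> I v.
Proof.
move=> I0 ID IZ Isp.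
have Isum (J : Type) (r : seq J) (F : J -> M) :
    (forall j, I (F j)) -> I (\sum_(j <- r) F j).
  by move=> IF; elim/big_rec: _ => // j x _; apply: ID.
suff Ihom m v : K v -> gpr m v = v -> I v.
  move=> v Kv; have [N ->] := gpr_sum v; apply: Isum => i.
  by apply: (Ihom i); [exact: (gs_gpr KG) | rewrite gpr_gpr eqxx].
elim/ltn_ind: m v => m IH v Kv vm.
have [u [w [v_uw Iu [s [sK ws]]]]] := Isp v Kv (ex_intro _ m vm).
rewrite -vm v_uw gprD; apply: (ID) => //.
rewrite ws (morphD_sum (gprD m)) big_seq; elim/big_rec: _ => // p x ps.
apply: (ID); have [p1 Kp2] := sK p ps.
have [N /(_ N (leqnn N)) ->] := gcomp_finite G p.1.
rewrite scaler_suml (morphD_sum (gprD m)); apply: Isum => i.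
have di := in_deg_gcomp G i p.1.
have [im|mi] := leqP i m; last by rewrite (gprZ0 _ di mi).
rewrite -{1}(subnKC im) (gprZ _ _ di).
have [i0|i_gt0] := posnP i.
  by rewrite i0 augmE p1 scale0r scale0r.
apply: (IZ); apply: (IH (m - i)%N).
- by rewrite ltn_subrL i_gt0 (leq_trans i_gt0).
- exact: (gs_gpr KG).
by rewrite gpr_gpr eqxx.
Qed.

(** A relation between elements of [K] that are linearly independent modulo
    [m K] has its coefficients in [m], because their images under the
    augmentation are the coefficients of a relation modulo [m K]. *)
Lemma minimal_generators : exists X : M -> Prop,
  [/\ forall x, X x -> K x, forall x, X x -> homogeneous x,
      forall v, K v -> exists f, free_lift (@incl M X) f = v &
      forall f, free_lift (@incl M X) f = 0 -> forall x, augm G f@_x = 0].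
Proof.
have [||X [XS Xind Xspan]] :=
    @basis_mod k R M (fun v => K v /\ homogeneous v) (aug_mul K).
- exact: aug_mul0.
- by move=> c v; apply: aug_mulZ.
exists X; split=> [x /XS []|x /XS []|v Kv|f f0 x] //.
  pose I v := exists f, free_lift (@incl M X) f = v.
  apply: (@graded_nakayama I) Kv; rewrite /I.
  - by exists 0; rewrite linear0.
  - by move=> u w [f <-] [g <-]; exists (f + g); rewrite linearD.
  - by move=> a u [f <-]; exists (a *: f); rewrite linearZ.
  move=> {}v Kv vh; have [f fX vf] := Xspan v (conj Kv vh).
  exists (kcomb f), (v - kcomb f); split=> [|i|//]; first by rewrite addrC subrK.
  rewrite /kcomb /mlift (morphD_sum (gprD i)) big_seq.
  elim/big_rec: _ => [|u w /fX Xu [g <-]].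
    by exists 0; rewrite linear0.
  have d0 : in_deg G 0 ((f@_u)%:A : R).
    by rewrite /in_deg augmE augm_in_alg.
  have [_ [j uj]] := XS u Xu.
  rewrite -[in gpr _ _](add0n i) (gprZ _ _ d0) -[X in gpr i X]uj gpr_gpr.
  case: eqP => [->|_]; last by exists g; rewrite scaler0 add0r.
  have Xu' : `[< X u >] by apply/asboolP.
  exists ((f@_u)%:A *: gen R (exist _ u Xu') + g).
  by rewrite linearD linearZ /= free_lift_gen /incl /= uj.
pose kf := mlift (fun (y : subset_type X) r => << augm G r *g val y >>) f.
have TD (y : subset_type X) : {morph (fun r => << augm G r *g val y >> : {malg k[M]})
    : r s / r + s}.
  by move=> r s; rewrite augmD monalgUD.
have T0 (y : subset_type X) : << augm G 0 *g val y >> = 0 :> {malg k[M]}.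
  exact: (morphD0 (TD y)).
have kf0 : kf = 0.
  apply: Xind => [v|].
    rewrite -mcoeff_neq0 /kf /mlift raddf_sum /= => nz.
    apply: contrapT => nXv; case/negP: nz; rewrite big1 // => y _.
    rewrite mcoeffU; case: eqP => // yv.
    by case: nXv; rewrite -yv; apply: subset_typeP.
  suff -> : kcomb kf =
      - \sum_(y <- msupp f) (f@_y - (augm G f@_y)%:A) *: (val y : M).
    rewrite -sumrN; elim/big_rec: _ => [|y u _]; first exact: aug_mul0.
    apply: aug_mulD; rewrite -scaleNr; apply: aug_mul1.
      by rewrite augmN augmB augm_in_alg subrr oppr0.
    exact: (XS _ (subset_typeP y)).1.
  apply/eqP; rewrite -subr_eq0 opprK /kf /mlift (morphD_sum (@kcombD _ _ _)).
  rewrite -big_split /= -[X in _ == X]f0; apply/eqP; apply: eq_bigr => y _.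
  by rewrite kcombU -scalerDl addrC subrK.
move/(congr1 (mcoeff (val x))): kf0; rewrite mcoeff0 => <-; rewrite /kf.
elim/malg_ind: f {f0 kf} => [|f g hf hg|y r].
- by rewrite mcoeff0 /mlift msupp0 big_seq_fset0 mcoeff0 (morphD0 (@augmD _ _ G)).
- by rewrite mcoeffD augmD mliftD // mcoeffD hf hg.
rewrite mliftU // !mcoeffU (inj_eq val_inj).
by case: eqP; rewrite // !mulr0n (morphD0 (@augmD _ _ G)).
Qed.
End Generators.

Section FreeGraded.
Variables (X : choiceType) (deg : X -> nat).

Definition free_pr (m : nat) (f : {malg R[X]}) : {malg R[X]} :=
  mlift (fun x r =>
    << (if (deg x <= m)%N then gcomp G (m - deg x) r else 0) *g x >>) f.

Let TD m x : {morph (fun r => << (if (deg x <= m)%N then gcomp G (m - deg x) r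
   else 0) *g x >> : {malg R[X]}) : r s / r + s}.
Proof.
by move=> r s; case: ifP => _; rewrite ?gcompD monalgUE // addr0.
Qed.

Fact free_prD m : {morph free_pr m : f g / f + g}.
Proof. by apply: mliftD => x; apply: TD. Qed.

Lemma free_prU m x r : free_pr m << r *g x >> =
  << (if (deg x <= m)%N then gcomp G (m - deg x) r else 0) *g x >>.
Proof. by rewrite /free_pr mliftU // => y; apply: (morphD0 (TD m y)). Qed.

Lemma free_prE m f x : (free_pr m f)@_x =
  if (deg x <= m)%N then gcomp G (m - deg x) f@_x else 0.
Proof.
elim/malg_ind: f => [|f g hf hg|y r].
- by rewrite (morphD0 (free_prD m)) !mcoeff0 gcomp_zero if_same.
- by rewrite free_prD !mcoeffD hf hg; case: ifP => _; rewrite ?gcompD ?addr0.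
rewrite free_prU !mcoeffU; case: eqP => [->|_]; rewrite ?mulr1n //.
by rewrite !mulr0n gcomp_zero if_same.
Qed.

Fact free_pr_pr i j f : free_pr i (free_pr j f) = if i == j then free_pr i f else 0.
Proof.
apply/malgP => x; rewrite !free_prE.
case: (i =P j) => [->|ij]; rewrite ?free_prE ?mcoeff0.
  by case: ifP => // xj; rewrite xj gcomp_gcomp eqxx.
case: ifP => // xi; case: ifP => xj; last by rewrite gcomp_zero.
rewrite gcomp_gcomp; case: eqP => // e; case: ij.
by rewrite -(subnK xi) e subnK.
Qed.

Fact free_pr_sum f : exists N, f = \sum_(i < N) free_pr i f.
Proof.
suff [N /(_ N (leqnn N)) fN] : exists N, forall N', (N <= N')%N ->
  f = \sum_(i < N') free_pr i f by exists N.
elim/malg_ind: f => [|f g [N1 h1] [N2 h2]|x r].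
- by exists 0%N => N _; rewrite big1 // => i _; rewrite (morphD0 (free_prD _)).
- exists (maxn N1 N2) => N; rewrite geq_max => /andP [/h1 e1 /h2 e2].
  by under eq_bigr do rewrite free_prD; rewrite big_split /= -e1 -e2.
have [N rN] := gcomp_finite G r; exists (deg x + N)%N => N' leN.
under eq_bigr do rewrite free_prU.
have le_x : (deg x <= N')%N by apply: leq_trans leN; apply: leq_addr.
rewrite -[N' in RHS](subnKC le_x) big_split_ord /= big1 ?add0r; last first.
  by move=> i _; rewrite leqNgt ltn_ord monalgU0.
under eq_bigr do rewrite leq_addr addKn.
rewrite -(morphD_sum (@monalgUD _ _ x)) -rN //.
by rewrite leq_subRL // addnC.
Qed.

Fact free_prZ i j a f : in_deg G i a -> free_pr (i + j) (a *: f) = a *: free_pr j f.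
Proof.
move=> ai; apply/malgP => x; rewrite mcoeffZ !free_prE mcoeffZ.
case: (leqP (deg x) j) => [xj|jx].
  rewrite (leq_trans xj (leq_addl _ _)) -addnBA //; exact: gcompMl.
rewrite mulr0; case: leqP => // xij; rewrite (gcompMl0 _ ai) //.
by rewrite ltn_subLR // addnC ltn_add2r.
Qed.

Fact free_prZ0 i m a f : in_deg G i a -> (m < i)%N -> free_pr m (a *: f) = 0.
Proof.
move=> ai mi; apply/malgP => x; rewrite mcoeff0 free_prE mcoeffZ.
case: ifP => // _; rewrite (gcompMl0 _ ai) //.
exact: leq_ltn_trans (leq_subr _ _) mi.
Qed.

Definition free_graded : grmod :=
  GrMod free_prD free_pr_pr free_pr_sum free_prZ free_prZ0.
End FreeGraded.

Section KernelGraded.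
Variables (M : grmod) (X : choiceType) (v : X -> M) (deg : X -> nat).
Hypothesis v_deg : forall x, gpr (deg x) (v x) = v x.

Lemma free_lift_pr m f : free_lift v (free_pr deg m f) = gpr m (free_lift v f).
Proof.
elim/malg_ind: f => [|f g hf hg|x r].
- by rewrite (morphD0 (free_prD _ _)) !linear0 gpr0.
- by rewrite free_prD !free_lift_morphD gprD hf hg.
rewrite free_prU -!scale_gen !linearZ /= free_lift_gen.
move: r; apply: (homog_ind (G := G)) => [|a b ha hb|i a ai].
- by rewrite gcomp_zero if_same !scale0r gpr0.
- rewrite scalerDl gprD -ha -hb -scalerDl.
  by case: ifP => _; rewrite ?gcompD ?addr0.
have [im|mi] := leqP i m; last first.
  rewrite (gprZ0 _ ai mi); case: ifP; rewrite ?scale0r // => _.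
  rewrite (gcomp_deg _ ai); case: eqP => [e|_]; rewrite ?scale0r //.
  by rewrite -e ltnNge leq_subr in mi.
rewrite -[in RHS](subnKC im) (gprZ _ _ ai) -v_deg gpr_gpr.
rewrite (gcomp_deg _ ai); case: (m - i =P deg x)%N => [e|ne].
  by rewrite -e leq_subr subKn // eqxx e.
case: ifP => xm; rewrite ?scale0r ?scaler0 //; case: eqP => e; last first.
  by rewrite scale0r.
by case: ne; rewrite -e subKn.
Qed.

Lemma kernel_graded_sub :
  graded_sub (M := free_graded deg) (fun f => free_lift v f = 0).
Proof.
split=> [|f g f0 g0|a f f0|i f f0].
- exact: linear0.
- by rewrite free_lift_morphD f0 g0 addr0.
- by rewrite free_liftZ f0 scaler0.
by rewrite [gpr i f]/(free_pr deg i f) free_lift_pr f0 gpr0.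
Qed.
End KernelGraded.

(** A step of the construction of a resolution: a graded module with the graded
    submodule that is to be covered by a free module. *)
Record stage := Stage {
  st_mod : grmod;
  st_sub : st_mod -> Prop;
  st_graded : graded_sub st_sub
}.

Definition st_gens (s : stage) : st_mod s -> Prop :=
  projT1 (cid (minimal_generators (st_graded s))).

Let st_gensP (s : stage) := projT2 (cid (minimal_generators (st_graded s))).

Definition st_type (s : stage) : choiceType := subset_type (@st_gens s).

Fact st_deg_ex (s : stage) (x : st_type s) : exists i, gpr i (val x) = val x.
Proof. by case: (st_gensP s) => _ h _ _; apply: h; apply: subset_typeP. Qed.

Definition st_deg (s : stage) (x : st_type s) : nat :=
  projT1 (cid (st_deg_ex x)).

Fact st_degP (s : stage) (x : st_type s) :
  gpr (st_deg x) (@incl (st_mod s) (@st_gens s) x) = incl x.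
Proof. exact: projT2 (cid (st_deg_ex x)). Qed.

Definition st_next (s : stage) : stage :=
  Stage (kernel_graded_sub (@st_degP s)).

Record minimal_free_resolution (M : lmodType R) (X : nat -> choiceType)
    (d : forall i, X i.+1 -> {malg R[X i]}) (aug : X 0%N -> M) : Prop := {
  mfr_surj : forall y, exists f, free_lift aug f = y;
  mfr_aug_d : forall x, free_lift aug (d 0%N x) = 0;
  mfr_dd : forall i x, free_lift (d i) (d i.+1 x) = 0;
  mfr_exact0 : forall f, free_lift aug f = 0 -> exists g, free_lift (d 0%N) g = f;
  mfr_exact : forall i f, free_lift (d i) f = 0 ->
    exists g, free_lift (d i.+1) g = f;
  mfr_min : forall i x y, augm G (d i x)@_y = 0
}.

(** The iterated kernels of free covers on minimal generators. Each covering is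
    minimal, since the kernel of the previous one consists of relations between
    minimal generators. *)
Lemma minimal_free_resolution_exists (M : grmod) :
  exists X d aug, @minimal_free_resolution M X d aug.
Proof.
have allM : graded_sub (fun _ : M => True) by [].
pose s i := iter i st_next (Stage allM).
exists (fun i => st_type (s i)), (fun i x => val x), (fun x => val x).
split.
- by move=> y; case: (st_gensP (s 0%N)) => _ _ h _; apply: h.
- by move=> x; case: (st_gensP (s 1%N)) => h _ _ _; apply: h; apply: subset_typeP.
- move=> i x; case: (st_gensP (s i.+2)) => h _ _ _; apply: h; exact: subset_typeP.
- by move=> f f0; case: (st_gensP (s 1%N)) => _ _ h _; apply: h.
- by move=> i f f0; case: (st_gensP (s i.+2)) => _ _ h _; apply: h.
move=> i x y; case: (st_gensP (s i)) => _ _ _ h; apply: h.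
by case: (st_gensP (s i.+1)) => h _ _ _; apply: h; exact: subset_typeP.
Qed.
End GradedModules.

Section RegularBimodule.
Variables (k : fieldType) (A : algType k) (G : connected_grading A).
Local Notation Ae := (Aenv A).

Let env_gcomp m p q l (a b x : A) : in_deg G p a -> in_deg G q b -> in_deg G l x ->
  gcomp G m (tens a b *: (x : Abim A) : A) =
  if m == (p + q + l)%N then tens a b *: (x : Abim A) else 0.
Proof.
move=> ap bq xl; rewrite tens_Abim (gcomp_deg _ (gcompM (gcompM ap xl) bq)).
by rewrite addnAC.
Qed.

Let env_gprZ i j (t : Ae) (x : Abim A) : in_deg (env_grading G) i t ->
  gcomp G (i + j) (t *: x : A) = (t *: (gcomp G j (x : A) : Abim A)) :> A.
Proof.
move=> <-; move: t; apply: (env_homog_ind (G := G)) => [|t u ht hu|p q a b ap bq].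
- by rewrite [gcomp (env_grading G) _ _]gcomp_zero !scale0r gcomp_zero.
- by rewrite [gcomp (env_grading G) _ _]gcompD !scalerDl gcompD ht hu.
rewrite [gcomp (env_grading G) _ _](env_comp_homog _ ap bq).
case: eqP => [->|_]; last by rewrite !scale0r gcomp_zero.
move: (x : A); apply: (homog_ind (G := G)) => [|y z hy hz|l y yl].
- by rewrite gcomp_zero !scaler0 gcomp_zero.
- by rewrite scalerDr !gcompD scalerDr hy hz.
rewrite (env_gcomp _ ap bq yl) (gcomp_deg _ yl) eqn_add2l.
by case: eqP => //; rewrite scaler0.
Qed.

Let env_gprZ0 i m (t : Ae) (x : Abim A) : in_deg (env_grading G) i t ->
  (m < i)%N -> gcomp G m (t *: x : A) = 0.
Proof.
move=> <- mi; move: t; apply: (env_homog_ind (G := G)) => [|t u ht hu|p q a b ap bq].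
- by rewrite [gcomp (env_grading G) _ _]gcomp_zero scale0r gcomp_zero.
- by rewrite [gcomp (env_grading G) _ _]gcompD scalerDl gcompD ht hu addr0.
rewrite [gcomp (env_grading G) _ _](env_comp_homog _ ap bq).
case: eqP => [ipq|_]; last by rewrite scale0r gcomp_zero.
move: (x : A); apply: (homog_ind (G := G)) => [|y z hy hz|l y yl].
- by rewrite scaler0 gcomp_zero.
- by rewrite scalerDr gcompD hy hz addr0.
rewrite (env_gcomp _ ap bq yl) -ipq; case: eqP => // e.
by rewrite e ltnNge leq_addr in mi.
Qed.

Let env_gpr_sum (x : Abim A) : exists N, x = \sum_(i < N) (gcomp G i (x : A) : Abim A).
Proof. by have [N /(_ N (leqnn N))] := gcomp_finite G x; exists N. Qed.

Definition regular_bimodule : grmod (env_grading G) :=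
  @GrMod k Ae (env_grading G) (Abim A) (gcomp G) (gcompD G) (gcomp_gcomp G)
    env_gpr_sum env_gprZ env_gprZ0.
End RegularBimodule.

(** * Projective resolutions *)

Section Comparison.
Variable R : nzRingType.

(** A projective module is a retract of the free module on its elements, so
    that lifting only requires the values to be lifted to lie in the image. *)
Lemma projective_lift (P M N : lmodType R) (f : {linear M -> N})
    (g : {linear P -> N}) : projective P ->
  (forall x, exists y, f y = g x) ->
  exists h : {linear P -> M}, forall x, f (h x) = g x.
Proof.
move=> projP /choice [h hP].
have [|i iP] := @projP {malg R[P]} P (free_lift id) idfun.
  by move=> p; exists (gen R p); apply: free_lift_gen.
exists (free_lift h \o i) => x /=.
transitivity (g (free_lift id (i x))); last by rewrite iP.
rewrite -[LHS]/((f \o free_lift h) (i x)) -[RHS]/((g \o free_lift id) (i x)).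
by apply: free_linear_eq => y; rewrite /= !free_lift_gen hP.
Qed.

Section Maps.
Variables (M : lmodType R) (P Q : resolution M).
Hypothesis projP : projective_resolution P.

Definition chain_map (f : forall i, {linear P i -> Q i}) :=
  forall i x, res_d Q i (f i.+1 x) = f i (res_d P i x).

Lemma res_dd (S : resolution M) i x : res_d S i (res_d S i.+1 x) = 0.
Proof. by apply/res_exact; exists x. Qed.

Lemma res_aug_d (S : resolution M) x : res_aug S (res_d S 0%N x) = 0.
Proof. by apply/res_exact0; exists x. Qed.

Lemma dependent_recursion (T : nat -> Type) (good : forall i, T i -> Prop)
    (step : forall i, T i -> T i.+1 -> Prop) :
  (exists x, good 0%N x) ->
  (forall i x, good i x -> exists2 y, good i.+1 y & step i x y) ->
  exists f : forall i, T i, (forall i, good i (f i)) /\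
    forall i, step i (f i) (f i.+1).
Proof.
move=> ex0 exS.
pose nxt i (x : {x | good i x}) := cid2 (exS i (projT1 x) (projT2 x)).
pose fix F i : {x | good i x} := if i is j.+1 then
  exist _ (s2val (nxt j (F j))) (s2valP (nxt j (F j))) else cid ex0.
exists (fun i => projT1 (F i)); split=> i; first exact: (projT2 (F i)).
exact: (s2valP' (nxt i (F i))).
Qed.

Lemma comparison : exists f : forall i, {linear P i -> Q i},
  chain_map f /\ forall x, res_aug Q (f 0%N x) = res_aug P x.
Proof.
have [f0 f0P] : exists f0 : {linear P 0%N -> Q 0%N},
    forall x, res_aug Q (f0 x) = res_aug P x.
  by apply: projective_lift => // x; apply: res_surj.
pose good i (f : {linear P i -> Q i}) := match i return {linear P i -> Q i} -> Prop with
  | 0 => fun f => forall x, res_aug Q (f x) = res_aug P x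
  | j.+1 => fun f => forall x, res_d Q j (f (res_d P j.+1 x)) = 0 end f.
pose step i (f : {linear P i -> Q i}) (g : {linear P i.+1 -> Q i.+1}) :=
  forall x, res_d Q i (g x) = f (res_d P i x).
have [||f [fg fs]] := @dependent_recursion _ good step.
- by exists f0.
- move=> i f fi.
  have [|g gP] := @projective_lift _ _ _ (res_d Q i) (f \o res_d P i) (@projP i.+1).
    move=> x; case: i f fi x => [|i] f fi x /=.
      by apply/res_exact0; rewrite fi res_aug_d.
    by apply/res_exact; apply: fi.
  by exists g => // x; rewrite gP /= res_dd linear0.
by exists f; split=> [i x|x]; [apply: fs | apply: (fg 0%N)].
Qed.

(** Two chain maps over the same map are homotopic; [f] is their
    difference. *)
Lemma homotopy (f : forall i, {linear P i -> Q i}) :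
  chain_map f -> (forall x, res_aug Q (f 0%N x) = 0) ->
  exists H : forall i, {linear P i -> Q i.+1},
    (forall x, res_d Q 0%N (H 0%N x) = f 0%N x) /\
    forall i x, res_d Q i.+1 (H i.+1 x) = f i.+1 x - H i (res_d P i x).
Proof.
move=> fc f0.
pose good i (h : {linear P i -> Q i.+1}) := forall x : P i.+1,
  res_d Q i (f i.+1 x - h (res_d P i x)) = 0.
pose step i (h : {linear P i -> Q i.+1}) (h' : {linear P i.+1 -> Q i.+2}) :=
  forall x, res_d Q i.+1 (h' x) = f i.+1 x - h (res_d P i x).
have [h0 h0P] : exists h0 : {linear P 0%N -> Q 1%N},
    forall x, res_d Q 0%N (h0 x) = f 0%N x.
  by apply: projective_lift => // x; apply/res_exact0.
pose ok i (h : {linear P i -> Q i.+1}) := good i h /\ (match i return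
  {linear P i -> Q i.+1} -> Prop with
  | 0 => fun h => forall x, res_d Q 0%N (h x) = f 0%N x | _ => fun=> True end) h.
have [||H [Hg Hs]] := @dependent_recursion _ ok step.
- by exists h0; split=> // x; rewrite linearB /= fc h0P subrr.
- move=> i h [hg _].
  have [u uE] : exists u : {linear P i.+1 -> Q i.+1},
      forall x, u x = f i.+1 x - h (res_d P i x).
    exact: (linear_sub (f i.+1) (h \o res_d P i)).
  have [|h' h'P] := @projective_lift _ _ _ (res_d Q i.+1) u (@projP i.+1).
    by move=> x; apply/res_exact; rewrite uE hg.
  exists h'; last by move=> x; rewrite h'P uE.
  by split=> // x; rewrite linearB /= fc h'P uE res_dd linear0 subr0 subrr.
by exists H; split=> [x|i x]; [apply: (Hg 0%N).2 | apply: Hs].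
Qed.
End Maps.

(** Both the composite and the identity lift the identity of [M]. *)
Lemma comparison_homotopy (M : lmodType R) (P Q : resolution M)
    (f : forall i, {linear P i -> Q i}) (g : forall i, {linear Q i -> P i}) :
  projective_resolution P ->
  chain_map f -> (forall x, res_aug Q (f 0%N x) = res_aug P x) ->
  chain_map g -> (forall x, res_aug P (g 0%N x) = res_aug Q x) ->
  exists H : forall i, {linear P i -> P i.+1},
    (forall x, res_d P 0%N (H 0%N x) = x - g 0%N (f 0%N x)) /\
    forall i x, res_d P i.+1 (H i.+1 x) =
      x - g i.+1 (f i.+1 x) - H i (res_d P i x).
Proof.
move=> projP fc fa gc ga.
pose u i := projT1 (cid (linear_sub idfun (g i \o f i))).
have uE i x : u i x = x - g i (f i x).
  exact: (projT2 (cid (linear_sub idfun (g i \o f i)))).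
have [||H [H0 HS]] := @homotopy M P P projP u.
- by move=> i x; rewrite !uE linearB gc fc.
- by move=> x; rewrite uE linearB ga fa subrr.
by exists H; split=> [x|i x]; rewrite ?H0 ?HS uE.
Qed.
End Comparison.

Section FreeResolution.
Variables (k : fieldType) (R : algType k) (G : connected_grading R).
Variables (M : lmodType R) (X : nat -> choiceType)
  (d : forall i, X i.+1 -> {malg R[X i]}) (aug : X 0%N -> M).
Hypothesis F : minimal_free_resolution G d aug.

Definition free_resolution : resolution M.
Proof.
refine (@Resolution R M (fun i => {malg R[X i]}) (fun i => free_lift (@d i))
  (free_lift aug) (mfr_surj F) _ _).
- move=> x; split; first exact: (mfr_exact0 F).
  move=> [y <-]; elim/malg_ind: y => [|f g hf hg|y r].
  + by rewrite !linear0.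
  + by rewrite !linearD /= hf hg addr0.
  by rewrite -scale_gen !linearZ /= free_lift_gen (mfr_aug_d F) scaler0.
- move=> i x; split; first exact: (mfr_exact F).
  move=> [y <-]; elim/malg_ind: y => [|f g hf hg|y r].
  + by rewrite !linear0.
  + by rewrite !linearD /= hf hg addr0.
  by rewrite -scale_gen !linearZ /= free_lift_gen (mfr_dd F) scaler0.
Defined.

Lemma free_resolution_projective : projective_resolution free_resolution.
Proof. by move=> i; apply: free_projective. Qed.
End FreeResolution.

(** * Equivariant bimodules *)

Section EnvelopingMaps.
Variables (k : fieldType) (A : algType k).
Local Notation Ae := (Aenv A).

Section Map.
Variable g : {lrmorphism A -> A}.

Lemma Aenv_mapD : {morph Aenv_map g : t u / t + u}.
Proof.
apply: (@eliftD _ _ _ (fun a b => tens (g a) (g b))); split=> [b c a a'|a c b b'].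
  by rewrite linearP tensDl tensZl.
by rewrite linearP tensDr tensZr.
Qed.

Lemma Aenv_mapM t u : Aenv_map g (t * u) = Aenv_map g t * Aenv_map g u.
Proof.
elim/Aenv_ind: t => [|t t' ht ht'|a b].
- by rewrite mul0r (morphD0 Aenv_mapD) mul0r.
- by rewrite mulrDl !Aenv_mapD ht ht' mulrDl.
elim/Aenv_ind: u => [|u u' hu hu'|c d].
- by rewrite mulr0 (morphD0 Aenv_mapD) mulr0.
- by rewrite mulrDr !Aenv_mapD hu hu' mulrDr.
by rewrite tensM !Aenv_map_tens tensM !rmorphM.
Qed.

Lemma Aenv_map1 : Aenv_map g 1 = 1.
Proof. by rewrite -tens11 Aenv_map_tens rmorph1. Qed.
End Map.

Section Action.
Variables (G : connected_grading A) (rho : graded_Zaction G).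

Lemma Aenv_map_rhoD i j t :
  Aenv_map (rho (i + j)) t = Aenv_map (rho i) (Aenv_map (rho j) t).
Proof.
move: t; apply: Aenv_morph_eq => [t u|t u|a b]; rewrite ?Aenv_mapD //.
by rewrite !Aenv_map_tens !zaD.
Qed.

Lemma Aenv_map_rho0 t : Aenv_map (rho 0) t = t.
Proof.
move: t; apply: (@Aenv_morph_eq _ _ _ _ id) => [t u|t u|a b] //.
  by rewrite Aenv_mapD.
by rewrite Aenv_map_tens !za0.
Qed.

Lemma act_semilinear (M : lmodType Ae) (act : int -> M -> M) i t x :
  compatible_action rho act ->
  act i (t *: x) = Aenv_map (rho i) t *: act i x.
Proof.
move=> ca; have D i' := ca_add ca i'.
elim/Aenv_ind: t => [|t u ht hu|a b].
- by rewrite scale0r (morphD0 (D i)) (morphD0 (Aenv_mapD _)) scale0r.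
- by rewrite scalerDl D ht hu Aenv_mapD scalerDl.
by rewrite (ca_compat ca) Aenv_map_tens.
Qed.

(** The coinduced equivariant bimodule, right adjoint to forgetting the
    action. *)
Definition coind (M : lmodType Ae) : Type := int -> M.
HB.instance Definition _ (M : lmodType Ae) := GRing.Zmodule.on (coind M).

Section Coinduced.
Variable M : lmodType Ae.
Definition coind_scale (t : Ae) (v : coind M) : coind M :=
  fun i => Aenv_map (rho i) t *: v i.
Fact coind_scaleA a b v :
  coind_scale a (coind_scale b v) = coind_scale (a * b) v.
Proof. by apply/funext => i; rewrite /coind_scale scalerA Aenv_mapM. Qed.
Fact coind_scale1 : left_id 1 coind_scale.
Proof. by move=> v; apply/funext => i; rewrite /coind_scale Aenv_map1 scale1r. Qed.
Fact coind_scaleDr : right_distributive coind_scale +%R.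
Proof. by move=> t u v; apply/funext => i; rewrite /coind_scale scalerDr. Qed.
Fact coind_scaleDl v : {morph coind_scale^~ v : a b / a + b}.
Proof.
by move=> a b; apply/funext => i; rewrite /coind_scale Aenv_mapD scalerDl.
Qed.
HB.instance Definition _ := GRing.Zmodule_isLmodule.Build Ae (coind M)
  coind_scaleA coind_scale1 coind_scaleDr coind_scaleDl.

Definition coind_act (j : int) (v : coind M) : coind M := fun i => v (i + j).

Lemma coind_compatible : compatible_action rho coind_act.
Proof.
split=> [v|i j v|i u v|i a b v]; apply/funext => l; rewrite /coind_act.
- by rewrite addr0.
- by rewrite addrA.
- by [].
rewrite -[LHS]/(Aenv_map (rho (l + i)) (tens a b) *: v (l + i)).
by rewrite Aenv_map_rhoD Aenv_map_tens.
Qed.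
End Coinduced.

(** Lift the map adjoint to [g] through the coinduced modules and evaluate the
    result at 0. *)
Lemma equivariant_projective_projective (P : lmodType Ae) (act : int -> P -> P) :
  compatible_action rho act -> equivariant_projective rho act -> projective P.
Proof.
move=> ca projP M N f g f_surj.
have [f' f'E] : exists f' : {linear coind M -> coind N}, forall v i, f' v i = f (v i).
  have [|f' f'E] := @linear_of _ (coind M) (coind N) (fun v i => f (v i)).
    by move=> t u v; apply/funext => i; rewrite linearP.
  by exists f' => v i; rewrite f'E.
have [g' g'E] : exists g' : {linear P -> coind N}, forall x i, g' x i = g (act i x).
  have [|g' g'E] := @linear_of _ P (coind N) (fun x i => g (act i x)).
    move=> t u v; apply/funext => i.
    by rewrite (ca_add ca) (act_semilinear _ _ _ ca) linearP.
  by exists g' => v i; rewrite g'E.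
have [|||h [_ hP]] := projP (coind M) (coind N) _ _ f' g'
  (coind_compatible M) (coind_compatible N).
- by move=> i v; apply/funext => l; rewrite f'E /coind_act f'E.
- by move=> i x; apply/funext => l; rewrite g'E /coind_act g'E (caD ca).
- move=> y; have /choice [x xP] : forall i, exists x, f x = y i by move=> i; apply: f_surj.
  by exists x; apply/funext => i; rewrite f'E xP.
have [h0 h0E] : exists h0 : {linear P -> M}, forall x, h0 x = h x 0.
  apply: linear_of => t x y; rewrite linearP.
  rewrite -[LHS]/(Aenv_map (rho 0) t *: h x 0 + h y 0).
  by rewrite Aenv_map_rho0.
by exists h0 => x; rewrite h0E -f'E hP g'E (ca0 ca).
Qed.
End Action.
End EnvelopingMaps.

(** * One-sided consequences of freeness *)

Section OneSided.
Variables (k : fieldType) (A : algType k).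
Local Notation Ae := (Aenv A).

(** A [k]-linear section of the canonical map from the vector space on the set
    [A] onto [A]; it exists because [A] has a basis over [k]. *)
Lemma linear_section : exists co : {linear A -> {malg k[A]}},
  forall a, kcomb (R := A) (V := A^o%type) (co a) = a.
Proof.
have [||B [_ Bind Bspan]] :=
  @basis_mod k A A^o%type (fun=> True) (fun v => v = 0) => //.
  by move=> c v ->; rewrite scaler0.
have /choice [co coP] : forall a : A,
    exists f : {malg k[A^o%type]}, supported B f /\ a = kcomb f.
  by move=> a; have [f fB /eqP] := Bspan a I; rewrite subr_eq0 => /eqP; exists f.
have co_lin : linear co.
  move=> c a b; apply/eqP; rewrite -subr_eq0; apply/eqP; apply: Bind.
    move=> v; rewrite -mcoeff_neq0 mcoeffB mcoeffD mcoeffZ => nz.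
    apply: contrapT => nB; case/negP: nz; have out a' : (co a')@_v = 0.
      by apply: mcoeff_outdom; apply/negP => /(coP a').1.
    by rewrite !out mulr0 addr0 subr0.
  rewrite (morphDB (@kcombD k A A^o%type)) kcombD kcombZ -!(coP _).2.
  by apply/eqP; rewrite subr_eq0; apply/eqP; rewrite /GRing.scale /= -scalerAl mul1r.
have [co' co'E] := linear_of co_lin.
by exists co' => a; rewrite co'E -(coP a).2.
Qed.

Lemma scale_in_alg (M : lmodType Ae) (c : k) (t : Ae) (x : M) :
  t *: (c%:A *: x) = c%:A *: (t *: x).
Proof. by rewrite !scalerA -scalerAl mul1r -scalerAr mulr1. Qed.

Lemma scale_scale (M : lmodType Ae) (c : k) (t : Ae) (x : M) :
  (c *: t) *: x = c%:A *: (t *: x).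
Proof. by rewrite scalerA -scalerAl mul1r. Qed.

Definition right_linear (M N : lmodType Ae) (f : M -> N) :=
  {morph f : x y / x + y} /\ forall b x, f (tens 1 b *: x) = tens 1 b *: f x.

(** A free bimodule is projective as a right module, because the left factor of
    each of its summands [A \otimes A] has a basis over [k]. A right linear map
    is chosen on the elements [b x], for [b] in [A] and [x] a generator, and
    [linear_section] makes the choice linear in [b]. *)
Lemma right_lift (X : choiceType) (N N' : lmodType Ae) (D : {linear N -> N'})
    (f : {malg Ae[X]} -> N') : right_linear f ->
  (forall p, exists n, D n = f p) ->
  exists s : {malg Ae[X]} -> N, right_linear s /\ forall p, D (s p) = f p.
Proof.
move=> [fD fZ] f_im; have [co coP] := linear_section.
have /choice [g gP] : forall p, exists n, D n = f p := f_im.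
pose h (x : X) (a : A) : kmod N :=
  mlift (fun b c => c%:A *: g (tens b 1 *: gen Ae x)) (co a).
have TD x b : {morph (fun c : k => c%:A *: g (tens b 1 *: gen Ae x)) : c c' / c + c'}.
  by move=> c c'; rewrite scalerDl scalerDl.
have T0 x b : (0 : k)%:A *: g (tens b 1 *: gen Ae x) = 0 by exact: (morphD0 (TD x b)).
have h_lin x : linear (h x).
  move=> c a b; rewrite /h linearP mliftD //; congr (_ + _).
  elim/malg_ind: (co a) => [|u v hu hv|a' c'].
  - by rewrite scaler0 (morphD0 (mliftD (TD x))) scaler0.
  - by rewrite scalerDr !mliftD // hu hv scalerDr.
  rewrite -scale_gen scalerA !scale_gen !mliftU // kmodE.
  by rewrite [in RHS]scalerA -scalerAl mul1r scalerA.
have bil x : (forall b, linear (fun u => tens 1 b *: (h x u : N) : kmod N)) /\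
    (forall u, linear (fun b => tens 1 b *: (h x u : N) : kmod N)).
  split=> [b c u v|u c b b'].
    by rewrite h_lin scalerDr kmodE scale_in_alg.
  by rewrite tensDr tensZr scalerDl scale_scale.
pose s := mlift (fun x (t : Ae) =>
  elift (fun u v => tens 1 v *: (h x u : N) : kmod N) t : N).
have sD : {morph s : p q / p + q}.
  by apply: mliftD => x; apply: (eliftD (bil x)).
have sU x u v : s << tens u v *g x >> = tens 1 v *: (h x u : N).
  rewrite /s mliftU; first by rewrite elift_tens.
  by move=> y; apply: (morphD0 (eliftD (bil y))).
have tens_gen u v b x : tens 1 b *: << tens u v *g x >> =
    << tens u (v * b) *g x >> :> {malg Ae[X]}.
  by rewrite -!scale_gen scalerA tensM mul1r.
exists s; split; first split=> // b.
  apply: bimodule_eq => [||u v x].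
  - exact: (morphD_comp sD (scale_morphD _)).
  - exact: (morphD_comp (scale_morphD _) sD).
  by rewrite tens_gen !sU scalerA tensM mul1r.
apply: bimodule_eq => [||u v x].
- exact: (morphD_comp (linear_morphD D) sD).
- exact: fD.
rewrite sU linearZ /= /h.
have -> : << tens u v *g x >> = tens 1 v *: << tens u 1 *g x >> :> {malg Ae[X]}.
  by rewrite tens_gen mul1r.
rewrite fZ; congr (_ *: _); rewrite -[in RHS](coP u) /mlift raddf_sum.
have tsum (I : Type) (r : seq I) (F : I -> A) :
    f << tens (\sum_(i <- r) F i) 1 *g x >> = \sum_(i <- r) f << tens (F i) 1 *g x >>.
  have e : {morph (fun a : A => f << tens a 1 *g x >>) : a b / a + b}.
    by move=> a b; rewrite tensDl monalgUD fD.
  exact: (morphD_sum e).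
rewrite /kcomb /mlift tsum; apply: eq_bigr => b _.
set c := mcoeff b _; transitivity (c%:A *: D (g (tens b 1 *: gen Ae x))).
  exact: linearZ.
rewrite gP -!scale_gen.
have -> : c%:A *: (b : A^o%type) = c *: b :> A.
  by rewrite /GRing.scale /= -scalerAl mul1r.
rewrite tensZl [in RHS]scale_scale.
have -> : c%:A = tens 1 c%:A :> Ae by rewrite tensZr.
by rewrite fZ.
Qed.

End OneSided.

Section Contraction.
Variables (k : fieldType) (A : algType k) (G : connected_grading A).
Local Notation Ae := (Aenv A).
Variables (X : nat -> choiceType) (d : forall i, X i.+1 -> {malg Ae[X i]})
  (aug : X 0%N -> Abim A).
Hypothesis F : minimal_free_resolution (env_grading G) d aug.

Local Notation D i := (free_lift (@d i)).
Local Notation eps := (free_lift aug).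

Lemma mfr_d_d i p : D i (D i.+1 p) = 0.
Proof. exact: (res_dd (S := free_resolution F) p). Qed.

Lemma mfr_eps_d p : eps (D 0%N p) = 0.
Proof. exact: (res_aug_d (S := free_resolution F) p). Qed.

Lemma right_linear_sub (M N : lmodType Ae) (f g : M -> N) :
  right_linear f -> right_linear g -> right_linear (fun x => f x - g x).
Proof.
move=> [fD fZ] [gD gZ]; split=> [x y|b x]; first by rewrite fD gD opprD addrACA.
by rewrite fZ gZ scalerBr.
Qed.

Lemma right_linear_pre (M N P : lmodType Ae) (f : {linear M -> N}) (g : N -> P) :
  right_linear g -> right_linear (fun x => g (f x)).
Proof.
by move=> [gD gZ]; split=> [x y|b x]; rewrite ?linearD ?gD ?linearZ ?gZ.
Qed.

(** A bimodule resolution of [A] splits as a complex of right modules, since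
    [A] and the free bimodules are projective on the right. *)
Lemma contraction : exists (p0 : {malg Ae[X 0%N]})
    (s : forall i, {malg Ae[X i]} -> {malg Ae[X i.+1]}),
  [/\ eps p0 = (1 : A), forall i, right_linear (s i),
      forall p, D 0%N (s 0%N p) = p - tens 1 (eps p) *: p0 &
      forall i p, D i.+1 (s i.+1 p) = p - s i (D i p)].
Proof.
have [p0 p0E] := mfr_surj F 1.
pose good i (s : {malg Ae[X i]} -> {malg Ae[X i.+1]}) :=
  [/\ right_linear s, forall p, D i (p - s (D i p)) = 0 &
    match i return ({malg Ae[X i]} -> {malg Ae[X i.+1]}) -> Prop with
    | 0 => fun s => forall p, D 0%N (s p) = p - tens 1 (eps p) *: p0
    | _ => fun=> True end s].
pose step i (s : {malg Ae[X i]} -> {malg Ae[X i.+1]})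
    (s' : {malg Ae[X i.+1]} -> {malg Ae[X i.+2]}) :=
  forall p, D i.+1 (s' p) = p - s (D i p).
have eta_rl : right_linear (fun p : {malg Ae[X 0%N]} => tens 1 (eps p) *: p0).
  split=> [p q|b p]; first by rewrite linearD tensDr scalerDl.
  by rewrite linearZ /= tens_Abim mul1r scalerA tensM mul1r.
have id_rl i : right_linear (id : {malg Ae[X i]} -> {malg Ae[X i]}) by [].
have [||s [gs ss]] := dependent_recursion (good := good) (step := step).
- have [p|s0 [s0R s0E]] := right_lift (D := D 0%N) (right_linear_sub (@id_rl 0%N) eta_rl).
    apply: (mfr_exact0 F).
    by rewrite linearB linearZ /= p0E tens_Abim !mul1r subrr.
  exists s0; split=> // p.
  by rewrite linearB s0E /= mfr_eps_d tens0r scale0r subr0 subrr.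
- move=> i s [sR sE _].
  have [p|s' [s'R s'E]] := right_lift (D := D i.+1)
      (right_linear_sub (@id_rl i.+1) (right_linear_pre (D i) sR)).
    exact/(mfr_exact F)/sE.
  exists s' => //; split=> // p.
  by rewrite linearB s'E /= mfr_d_d (morphD0 sR.1) subr0 subrr.
exists p0, s; split=> // [i|p]; first by case: (gs i).
by case: (gs 0%N).
Qed.

(** * Base change to the trivial module *)

(** The ring morphism [A^e -> A] killing the augmentation ideal of the right
    factor; base change along it is [- \otimes_A k]. *)
Definition right_aug : Ae -> A := elift (fun u v => augm G v *: u).

Let ra_bil : (forall b, linear (fun u : A => augm G b *: u)) /\
  (forall a : A, linear (fun v : A => augm G v *: a)).
Proof.
split=> [b c u v|a c u v]; last by rewrite augmD augmZ scalerDl scalerA.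
by rewrite scalerDr !scalerA mulrC.
Qed.

Lemma right_augD : {morph right_aug : t u / t + u}.
Proof. exact: eliftD. Qed.

Lemma right_aug_tens u v : right_aug (tens u v) = augm G v *: u.
Proof. exact: elift_tens. Qed.

Lemma right_augM t u : right_aug (t * u) = right_aug t * right_aug u.
Proof.
elim/Aenv_ind: t => [|t t' ht ht'|a b].
- by rewrite mul0r (morphD0 right_augD) mul0r.
- by rewrite mulrDl !right_augD ht ht' mulrDl.
elim/Aenv_ind: u => [|u u' hu hu'|a' b'].
- by rewrite mulr0 (morphD0 right_augD) mulr0.
- by rewrite mulrDr !right_augD hu hu' mulrDr.
rewrite tensM !right_aug_tens augmM -scalerAl -scalerAr scalerA.
by rewrite [in RHS]mulrC.
Qed.

Lemma augm_right_aug t : augm G (right_aug t) = augm (env_grading G) t.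
Proof.
move: t; apply: Aenv_morph_eq => [t u|t u|a b].
- by rewrite right_augD augmD.
- by rewrite augmD.
by rewrite right_aug_tens augm_tens augmZ mulrC.
Qed.

Section Coefficients.
Variable Y : choiceType.

Definition bc (p : {malg Ae[Y]}) : {malg A[Y]} :=
  mlift (fun y t => << right_aug t *g y >>) p.

Definition bc_lift (q : {malg A[Y]}) : {malg Ae[Y]} :=
  mlift (fun y a => << tens a 1 *g y >>) q.

Let bcT (y : Y) : {morph (fun t => << right_aug t *g y >> : {malg A[Y]}) : t u / t + u}.
Proof. by move=> t u; rewrite right_augD monalgUD. Qed.

Let liftT (y : Y) : {morph (fun a => << tens a 1 *g y >> : {malg Ae[Y]}) : a b / a + b}.
Proof. by move=> t u; rewrite tensDl monalgUD. Qed.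

Lemma bcD : {morph bc : p q / p + q}. Proof. exact: mliftD. Qed.

Lemma bcU t y : bc << t *g y >> = << right_aug t *g y >>.
Proof. by rewrite /bc mliftU // => x; apply: (morphD0 (bcT x)). Qed.

Lemma bc_liftD : {morph bc_lift : p q / p + q}. Proof. exact: mliftD. Qed.

Lemma bc_liftU t y : bc_lift << t *g y >> = << tens t 1 *g y >>.
Proof. by rewrite /bc_lift mliftU // => x; apply: (morphD0 (liftT x)). Qed.

Lemma bcZ t p : bc (t *: p) = right_aug t *: bc p.
Proof.
move: p; apply: malg_morph_eq => [||x u].
- exact: (morphD_comp bcD (scale_morphD t)).
- exact: (morphD_comp (scale_morphD _) bcD).
by rewrite -scale_gen scalerA !scale_gen !bcU right_augM -!scale_gen scalerA.
Qed.

Lemma bcE p y : (bc p)@_y = right_aug p@_y.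
Proof.
elim/malg_ind: p => [|p q hp hq|x u].
- by rewrite (morphD0 bcD) !mcoeff0 (morphD0 right_augD).
- by rewrite bcD !mcoeffD right_augD hp hq.
by rewrite bcU !mcoeffU; case: eqP; rewrite // !mulr0n (morphD0 right_augD).
Qed.

Lemma bc_liftK q : bc (bc_lift q) = q.
Proof.
elim/malg_ind: q => [|p q hp hq|x u].
- by rewrite (morphD0 bc_liftD) (morphD0 bcD).
- by rewrite bc_liftD bcD hp hq.
by rewrite bc_liftU bcU right_aug_tens augm1 scale1r.
Qed.

End Coefficients.

(** Right linear maps descend along base change, which kills what right
    multiplication by the augmentation ideal produces. *)
Lemma bc_right_linear (Y Z : choiceType) (s : {malg Ae[Y]} -> {malg Ae[Z]}) p :
  right_linear s -> bc (s p) = bc (s (bc_lift (bc p))).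
Proof.
move=> [sD sZ]; have bD := @bcD; move: p; apply: bimodule_eq => [||u v x].
- exact: (morphD_comp (bD _) sD).
- apply: (morphD_comp (bD _)); apply: (morphD_comp sD).
  exact: (morphD_comp (@bc_liftD _) (bD _)).
rewrite bcU bc_liftU right_aug_tens.
have gE b : << tens u b *g x >> = tens 1 b *: << tens u 1 *g x >> :> {malg Ae[Y]}.
  by rewrite -!scale_gen scalerA tensM !mul1r.
have -> : tens (augm G v *: u) 1 = tens u (augm G v)%:A :> Ae.
  by rewrite tensZl tensZr.
rewrite (gE v) (gE (augm G v)%:A) (sZ v) (sZ (augm G v)%:A) !bcZ.
by rewrite !right_aug_tens augm_in_alg.
Qed.

Definition bc_d i (x : X i.+1) : {malg A[X i]} := bc (d x).
Definition bc_aug (x : X 0%N) : kleft G := augm G (aug x : A).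

Local Notation bD i := (free_lift (@bc_d i)).

Lemma bc_dE i p : bc (D i p) = bD i (bc p).
Proof.
move: p; apply: malg_morph_eq => [||x t].
- exact: (morphD_comp (@bcD _) (linear_morphD (D i))).
- exact: (morphD_comp (linear_morphD (bD i)) (@bcD _)).
by rewrite bcU -!scale_gen !linearZ /= !free_lift_gen bcZ.
Qed.

Lemma bc_augE p : free_lift bc_aug (bc p) = augm G (eps p : A).
Proof.
elim/malg_ind: p => [|p q hp hq|x t].
- by rewrite linear0 (morphD0 (@bcD _)) linear0 (morphD0 (@augmD _ _ G)).
- by rewrite bcD !free_lift_morphD hp hq [in RHS]augmD.
rewrite bcU -!scale_gen !linearZ /= !free_lift_gen.
rewrite -[LHS]/(augm G (right_aug t) * augm G (aug x : A)).
elim/Aenv_ind: t => [|t u ht hu|u v].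
- by rewrite (morphD0 right_augD) scale0r (morphD0 (@augmD _ _ G)) mul0r.
- by rewrite right_augD augmD mulrDl ht hu scalerDl [in RHS]augmD.
rewrite tens_Abim right_aug_tens !augmM augmZ.
by rewrite -mulrA [RHS]mulrC.
Qed.

(** Tensoring a minimal free bimodule resolution of [A] with the trivial module
    on the right gives a minimal free resolution of the trivial module: the
    right linear contraction descends. *)
Lemma base_change_resolution : minimal_free_resolution (M := kleft G) G bc_d bc_aug.
Proof.
have [p0 [s [p0E sR s0E sE]]] := contraction.
split.
- move=> c; have [p pE] := mfr_surj F (c%:A : A).
  by exists (bc p); rewrite bc_augE pE augm_in_alg.
- move=> x; have := bc_augE (d x); rewrite /bc_d => ->.
  by rewrite (mfr_aug_d F) (morphD0 (@augmD _ _ G)).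
- by move=> i x; rewrite /bc_d -bc_dE (mfr_dd F) (morphD0 (@bcD _)).
- move=> q q0; exists (bc (s 0%N (bc_lift q))); rewrite -bc_dE s0E.
  rewrite (morphDB (@bcD _)) bc_liftK bcZ right_aug_tens.
  by rewrite -bc_augE bc_liftK q0 scale0r scale0r subr0.
- move=> i q q0; exists (bc (s i.+1 (bc_lift q))); rewrite -bc_dE sE.
  rewrite (morphDB (@bcD _)) bc_liftK (bc_right_linear _ (sR i)) bc_dE bc_liftK.
  by rewrite q0 (morphD0 (@bc_liftD _)) (morphD0 (sR i).1) (morphD0 (@bcD _)) subr0.
by move=> i x y; rewrite /bc_d bcE augm_right_aug (mfr_min F).
Qed.
End Contraction.

(** * Length and last term of the minimal resolution *)

Section MinimalTrivial.
Variables (k : fieldType) (A : algType k) (G : connected_grading A).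
Variables (X : nat -> choiceType) (d : forall i, X i.+1 -> {malg A[X i]})
  (aug : X 0%N -> kleft G).
Hypothesis F : minimal_free_resolution (M := kleft G) G d aug.
Local Notation Q := (free_resolution F).
Local Notation Q_proj := (@free_resolution_projective _ _ _ _ _ _ _ F).

(** Minimality: any linear map kills the differential of a generator up to the
    augmentation ideal. *)
Lemma augm_linear_d i (f : {linear {malg A[X i]} -> A^o}) x :
  augm G (f (d x) : A) = 0.
Proof.
rewrite [d x]malg_gens raddf_sum /= (morphD_sum (@augmD _ _ G)) big1 // => y _.
by rewrite linearZ /= augmM (mfr_min F) mul0r.
Qed.

Lemma augm_linear_bd i (f : {linear {malg A[X i]} -> A^o}) p :
  augm G (f (free_lift (@d i) p) : A) = 0.
Proof.
elim/malg_ind: p => [|p q hp hq|x r].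
- by rewrite !linear0 (morphD0 (@augmD _ _ G)).
- by rewrite free_lift_morphD linearD augmD hp hq addr0.
by rewrite -scale_gen free_liftZ linearZ /= free_lift_gen augmM augm_linear_d mulr0.
Qed.

Lemma mcoeff_linear (Y : choiceType) (y : Y) : exists f : {linear {malg A[Y]} -> A^o},
  forall p, f p = p@_y.
Proof. by apply: linear_of => r p q; rewrite mcoeffD mcoeffZ. Qed.

Lemma malg_empty (Y : choiceType) (p : {malg A[Y]}) : (Y -> False) -> p = 0.
Proof. by move=> nY; apply/malgP => y; case: (nY y). Qed.

Lemma resolution_bounded d' : projdim_le (kleft G) d' ->
  forall i, (d' < i)%N -> X i -> False.
Proof.
move=> [P [projP P0]] [|i] di x //.
have [f [fc fa]] := comparison P Q_proj.
have [g [gc ga]] := comparison Q projP.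
have [H [_ HS]] := comparison_homotopy Q_proj fc fa gc ga.
have := HS i (gen A x); rewrite (P0 _ di (f _ _)) linear0 subr0 => /= HE.
have [cx cxE] := mcoeff_linear x.
have : augm G (cx (gen A x)) = 0.
  have -> : gen A x = free_lift (@d i.+1) (H i.+1 (gen A x)) + H i (d x).
    by rewrite HE free_lift_gen subrK.
  rewrite linearD augmD (augm_linear_d (cx \o H i)) addr0.
  exact: (augm_linear_bd cx).
by rewrite cxE mcoeffUU augm1 => /eqP; rewrite oner_eq0.
Qed.

Lemma generators0_inhabited : exists x : X 0%N, True.
Proof.
apply: contrapT => nX; have [p pE] := mfr_surj F (1 : k).
have p0 : p = 0 by apply: malg_empty => x; apply: nX; exists x.
by move: pE; rewrite p0 linear0 => /eqP; rewrite eq_sym (@oner_eq0 k).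
Qed.

Lemma coboundary_augm i (g : Q i -> A^o) : coboundary (P := Q) g ->
  forall x, augm G (g (gen A x) : A) = 0.
Proof.
case: i g => [|i] g /=; first by move=> g0 x; rewrite g0 (morphD0 (@augmD _ _ G)).
by move=> [h hE] x; rewrite hE /= free_lift_gen augm_linear_d.
Qed.

Lemma coeff_cocycle i (x : X i) : (X i.+1 -> False) ->
  cocycle (P := Q) (i := i) (N := A^o%type) (fun p => p@_x).
Proof.
move=> nX; split=> [r p q|p]; first by rewrite mcoeffD mcoeffZ.
by rewrite [p](malg_empty _ nX) linear0 mcoeff0.
Qed.

(** Since the coefficient functions on the last term are cocycles and
    coboundaries have values in the augmentation ideal, the Ext condition fixes
    the length of the resolution and the rank of its last term. *)
Lemma last_generator n : gldim_finite A ->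
  Ext_concentrated (in_alg A) (kleft G : lmodType A) A^o%type n ->
  (exists x : X n, forall y, y = x) /\ (X n.+1 -> False).
Proof.
move=> [d' /(_ (kleft G)) /resolution_bounded bnd] /(_ Q Q_proj).
move=> [[f [fc _ fgen]] E0].
have [D [[xD _] Dmax]] : exists D, (exists x : X D, True) /\
    forall i, (D < i)%N -> X i -> False.
  suff [m mE] : exists m, forall j, (m < j)%N -> X j -> False; last by exists d'.
    elim: m mE => [|m IH] mE; first by exists 0%N; split=> //; apply: generators0_inhabited.
    have [xm|nx] := pselect (exists x : X m.+1, True); first by exists m.+1.
    apply: IH => j; rewrite leq_eqVlt => /orP [/eqP <-|]; last exact: mE.
    by move=> x; apply: nx; exists x.
have nD : n = D.
  apply: contrapT => nD; have nD' : D <> n by move=> e; case: nD.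
  have /coboundary_augm /(_ xD) := E0 D nD' _ (coeff_cocycle xD (Dmax D.+1 (ltnSn D))).
  by rewrite mcoeffUU augm1 => /eqP; rewrite oner_eq0.
rewrite {}nD in f fc fgen *; split; last exact: Dmax.
exists xD => y; apply: contrapT => yx.
have coef z : exists c : k, forall w, augm G (gen A w)@_z = c * augm G (f (gen A w)).
  have [c /coboundary_augm ce] := fgen _ (coeff_cocycle z (Dmax D.+1 (ltnSn D))).
  exists c => w; have := ce w; rewrite augmB => /eqP; rewrite subr_eq0 => /eqP ->.
  by rewrite augmM augm_in_alg.
have [cx cxE] := coef xD; have [cy cyE] := coef y.
have := cxE xD; rewrite mcoeffUU augm1 => e1.
have := cxE y; rewrite mcoeffU (introF eqP yx) (morphD0 (@augmD _ _ G)) => e2.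
have := cyE y; rewrite mcoeffUU augm1 => e3.
move/esym/eqP: e2; rewrite mulf_eq0 => /orP [] /eqP z0.
  by move: e1; rewrite z0 mul0r => /eqP; rewrite oner_eq0.
by move: e3; rewrite z0 mulr0 => /eqP; rewrite oner_eq0.
Qed.
End MinimalTrivial.

(** * Rotation of twisted cycles *)

Section Signs.
Variable V : zmodType.

(** The sign [(-1)^i] on an abelian group without a ring of scalars at hand. *)
Definition sg (i : nat) (v : V) : V := if odd i then - v else v.

Lemma sgS i v : sg i.+1 v = - sg i v.
Proof. by rewrite /sg /=; case: odd; rewrite ?opprK. Qed.

Lemma sgD i : {morph sg i : u v / u + v}.
Proof. by move=> u v; rewrite /sg; case: odd => //; rewrite opprD. Qed.

Lemma sgK i : involutive (sg i).
Proof. by move=> v; rewrite /sg; case: odd; rewrite ?opprK. Qed.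
End Signs.

Lemma morph_sg (U V : zmodType) (f : U -> V) i v :
  {morph f : x y / x + y} -> f (sg i v) = sg i (f v).
Proof. by move=> fD; rewrite /sg; case: odd => //; rewrite (morphDN fD). Qed.

Section CoefficientMap.
Variables (Y : choiceType) (E E' : zmodType) (f : E -> E').
Hypothesis fD : {morph f : x y / x + y}.

Definition cmap (w : {malg E[Y]}) : {malg E'[Y]} :=
  mlift (fun y q => << f q *g y >>) w.

Let cmapT (y : Y) : {morph (fun q => << f q *g y >> : {malg E'[Y]}) : p q / p + q}.
Proof. by move=> p q; rewrite fD monalgUD. Qed.

Lemma cmapD : {morph cmap : v w / v + w}. Proof. exact: mliftD. Qed.

Lemma cmapE w y : (cmap w)@_y = f w@_y.
Proof.
move: w; apply: malg_morph_eq => [||x q].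
- exact: (morphD_comp (mcoeffD y) cmapD).
- exact: (morphD_comp fD (mcoeffD y)).
rewrite /cmap mliftU => [|z]; last exact: (morphD0 (cmapT z)).
by rewrite !mcoeffU; case: eqP; rewrite // !mulr0n (morphD0 fD).
Qed.

Lemma cmapU q y : cmap << q *g y >> = << f q *g y >>.
Proof. by rewrite /cmap mliftU // => z; apply: (morphD0 (cmapT z)). Qed.
End CoefficientMap.

Section Balanced.
Variables (k : fieldType) (A : algType k).
Local Notation Ae := (Aenv A).
Variables (Y : choiceType) (E : lmodType Ae) (g : Y -> E -> E).
Hypothesis gR : forall y, right_linear (g y).

(** The bimodule map out of the tensor product over [A] of a free bimodule and
    [E] that is prescribed by its values [g y q] at [y \otimes q]. *)
Definition pairing (p : {malg Ae[Y]}) (q : E) : E :=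
  mlift (fun y t =>
    elift (fun u v => tens u 1 *: g y (tens v 1 *: q) : kmod E) t : E) p.

Let g_kscale y (c : k) q : g y (c%:A *: q) = c%:A *: g y q.
Proof. by rewrite -tens11 -tensZr (gR y).2. Qed.

Let bil y q :
  (forall v, linear (fun u => tens u 1 *: g y (tens v 1 *: q) : kmod E)) /\
  (forall u : A, linear (fun v => tens u 1 *: g y (tens v 1 *: q) : kmod E)).
Proof.
split=> [v c u u'|u c v v'].
  by rewrite tensDl tensZl scalerDl scale_scale.
rewrite tensDl tensZl scalerDl scale_scale (gR y).1 g_kscale.
by rewrite scalerDr scale_in_alg.
Qed.

Let pT y q : {morph (fun t => elift (fun u v => tens u 1 *: g y (tens v 1 *: q)
   : kmod E) t : E) : t t' / t + t'}.
Proof. exact: (eliftD (bil y q)). Qed.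

Lemma pairingDl q : {morph pairing^~ q : p p' / p + p'}.
Proof. by apply: mliftD => y; apply: pT. Qed.

Lemma pairingU u v y q :
  pairing << tens u v *g y >> q = tens u 1 *: g y (tens v 1 *: q).
Proof.
rewrite /pairing mliftU => [|z]; last exact: (morphD0 (pT z q)).
exact: (elift_tens (bil y q)).
Qed.

Lemma pairing_gen y q : pairing (gen Ae y) q = g y q.
Proof. by rewrite /gen -tens11 pairingU !tens11 !scale1r. Qed.

Lemma pairingDr p : {morph pairing p : q q' / q + q'}.
Proof.
move=> q q'; move: p; apply: bimodule_eq => [||u v y].
- exact: pairingDl.
- exact: (morphD_add (pairingDl q) (pairingDl q')).
by rewrite !pairingU scalerDr (gR y).1 scalerDr.
Qed.

Lemma pairingZr p b q : pairing p (tens 1 b *: q) = tens 1 b *: pairing p q.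
Proof.
move: p; apply: bimodule_eq => [||u v y].
- exact: pairingDl.
- exact: (morphD_comp (scale_morphD _) (pairingDl q)).
rewrite !pairingU scalerA tens_comm -scalerA (gR y).2 !scalerA.
by rewrite tens_comm.
Qed.

Let tens_tens a b u v y : tens a b *: << tens u v *g y >> =
  << tens (a * u) (v * b) *g y >> :> {malg Ae[Y]}.
Proof. by rewrite -!scale_gen scalerA tensM. Qed.

Lemma pairingZl a p q : pairing (tens a 1 *: p) q = tens a 1 *: pairing p q.
Proof.
move: p; apply: bimodule_eq => [||u v y].
- exact: (morphD_comp (pairingDl q) (scale_morphD _)).
- exact: (morphD_comp (scale_morphD _) (pairingDl q)).
by rewrite tens_tens !pairingU mulr1 scalerA tensM mulr1.
Qed.

Lemma pairing_balanced b p q :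
  pairing (tens 1 b *: p) q = pairing p (tens b 1 *: q).
Proof.
move: p; apply: bimodule_eq => [||u v y].
- exact: (morphD_comp (pairingDl q) (scale_morphD _)).
- exact: pairingDl.
by rewrite tens_tens !pairingU mul1r scalerA tensM mulr1.
Qed.

Lemma pairingZ a b p q :
  pairing (tens a b *: p) q = tens a 1 *: pairing p (tens b 1 *: q).
Proof. by rewrite tensE -scalerA pairingZl pairing_balanced. Qed.
End Balanced.

Section Total.
Variables (k : fieldType) (A : algType k).
Local Notation Ae := (Aenv A).
Variable X : nat -> choiceType.
Local Notation Fr i := {malg Ae[X i]}.

Definition total_module : Type := {malg Ae[{i : nat & X i}]}.
HB.instance Definition _ := GRing.Lmodule.on total_module.

Definition summand (i : nat) : Fr i -> total_module :=
  free_lift (fun x => gen Ae (existT X i x)).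
HB.instance Definition _ i := GRing.Linear.on (@summand i).

Lemma summandU i t x : summand << t *g x >> = << t *g existT X i x >>.
Proof. by rewrite -!scale_gen /summand free_liftZ free_lift_gen. Qed.

Lemma total_eq (V : zmodType) (f g : total_module -> V) :
  {morph f : p q / p + q} -> {morph g : p q / p + q} ->
  (forall i (p : Fr i), f (summand p) = g (summand p)) -> f =1 g.
Proof.
move=> fD gD fg; apply: malg_morph_eq => // [[i x] t].
by rewrite -(summandU t x).
Qed.

Section Tot.
Variables (N : zmodType) (f : forall i, Fr i -> N).
Hypothesis fD : forall i, {morph @f i : p q / p + q}.

Definition tot : total_module -> N :=
  mlift (fun (y : {i : nat & X i}) t => f << t *g projT2 y >>).

Let totT (y : {i : nat & X i}) : {morph (fun t => f << t *g projT2 y >>) : t u / t + u}.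
Proof. by move=> t u; rewrite monalgUD fD. Qed.

Lemma totD : {morph tot : p q / p + q}. Proof. exact: (mliftD totT). Qed.

Lemma tot_summand i (p : Fr i) : tot (summand p) = f p.
Proof.
move: p; apply: malg_morph_eq => [p q||x t]; [|exact: fD|].
  by rewrite linearD totD.
rewrite summandU /tot mliftU // => y; exact: (morphD0 (totT y)).
Qed.
End Tot.

(** Abstracting the direct sum from its construction keeps the terms of the
    rotation argument small. *)
Lemma direct_sum_exists : exists (E : lmodType Ae) (inj : forall i, {linear Fr i -> E}),
  (forall (V : zmodType) (f g : E -> V),
    {morph f : p q / p + q} -> {morph g : p q / p + q} ->
    (forall i (p : Fr i), f (inj i p) = g (inj i p)) -> f =1 g) /\
  (forall (N : zmodType) (f : forall i, Fr i -> N),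
    (forall i, {morph @f i : p q / p + q}) ->
    exists2 h : E -> N, {morph h : p q / p + q} & forall i p, h (inj i p) = f i p).
Proof.
exists total_module, (fun i => @summand i); split; first exact: total_eq.
by move=> N f fD; exists (tot f); [apply: totD | apply: tot_summand].
Qed.
End Total.

Section Rotation.
Variables (k : fieldType) (A : algType k).
Local Notation Ae := (Aenv A).
Variables (X : nat -> choiceType) (d : forall i, X i.+1 -> {malg Ae[X i]})
  (aug : X 0%N -> Abim A).
Local Notation Fr i := {malg Ae[X i]}.
Local Notation D i := (free_lift (@d i)).
Local Notation eps0 := (free_lift aug).
Hypotheses (dd0 : forall i p, D i (D i.+1 p) = 0)
  (eps_d0 : forall p, eps0 (D 0%N p) = 0).

(** [E] is the direct sum of the terms of the resolution. *)
Variables (E : lmodType Ae) (inj : forall i, {linear Fr i -> E}).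
Arguments inj {i}.
Hypotheses (E_eq : forall (V : zmodType) (f g : E -> V),
    {morph f : p q / p + q} -> {morph g : p q / p + q} ->
    (forall i (p : Fr i), f (inj p) = g (inj p)) -> f =1 g)
  (E_ext : forall (N : zmodType) (f : forall i, Fr i -> N),
    (forall i, {morph @f i : p q / p + q}) ->
    exists2 h : E -> N, {morph h : p q / p + q} & forall i p, h (inj p) = f i p).

Variables (dT : {linear E -> E}) (eps : {linear E -> Abim A})
  (s : E -> E) (p0 : E).
Hypotheses (dT0 : forall p : Fr 0%N, dT (inj p) = 0)
  (dTS : forall i (p : Fr i.+1), dT (inj p) = inj (D i p))
  (eps_0 : forall p : Fr 0%N, eps (inj p) = eps0 p)
  (eps_S : forall i (p : Fr i.+1), eps (inj p) = 0)
  (s_right : right_linear s)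
  (s_contr : forall p, dT (s p) = p - s (dT p) - tens 1 (eps p) *: p0)
  (eps_s : forall p, eps (s p) = 0)
  (eps_p0 : eps p0 = 1 :> A) (d_p0 : dT p0 = 0).

Lemma injZ i t (p : Fr i) : inj (t *: p) = t *: inj p.
Proof. exact: linearZ. Qed.

Lemma dTZ t p : dT (t *: p) = t *: dT p.
Proof. exact: linearZ. Qed.

Lemma epsZ a b p : eps (tens a b *: p) = a * (eps p : A) * b :> A.
Proof. by rewrite linearZ /= tens_Abim. Qed.

Lemma eps_dT p : eps (dT p) = 0.
Proof.
move: p; apply: E_eq => [||[|[|i]] p].
- exact: (morphD_comp (linear_morphD eps) (linear_morphD dT)).
- exact: morphD_cst0.
- by rewrite dT0 linear0.
- by rewrite dTS eps_0 eps_d0.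
by rewrite dTS eps_S.
Qed.

(** ** A homotopy between the two augmentations of the tensor square

    The bimodule maps [p \otimes q |-> eps p q] and [p \otimes q |-> p eps q]
    from the tensor square of the resolution to the resolution are homotopic.
    As the contraction [s] is right linear, a homotopy is obtained by applying
    it to what the homotopy relation prescribes on [x \otimes q], for [x] a
    free generator, and extending on the left. *)
Fixpoint hty (i : nat) : X i -> E -> E :=
  match i return X i -> E -> E with
  | 0 => fun x q => s (tens (eps0 (gen Ae x)) 1 *: q - tens 1 (eps q) *: inj (gen Ae x))
  | j.+1 => fun x q => s (- (tens 1 (eps q) *: inj (gen Ae x)) - pairing (@hty j) (d x) q)
  end.

Definition hty_d (i : nat) : Fr i -> E -> E :=
  match i return Fr i -> E -> E with
  | 0 => fun _ _ => 0
  | j.+1 => fun p q => pairing (@hty j) (D j p) q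
  end.

Definition eps_lvl (i : nat) : Fr i -> A :=
  match i return Fr i -> A with 0 => fun p => eps0 p | _ => fun=> 0 end.

Lemma eps_lvlE i (p : Fr i) : eps_lvl p = eps (inj p).
Proof. by case: i p => [|i] p /=; rewrite ?eps_0 ?eps_S. Qed.

Lemma htyE i (x : X i) q : hty x q =
  s (tens (eps_lvl (gen Ae x)) 1 *: q - tens 1 (eps q) *: inj (gen Ae x)
     - hty_d (gen Ae x) q).
Proof.
case: i x => [|i] x /=; first by rewrite subr0.
by rewrite tens0l scale0r sub0r free_lift_gen.
Qed.

Lemma hty_right i (x : X i) : right_linear (hty x).
Proof.
elim: i x => [|i IH] x; split=> [p q|b p] /=.
- rewrite -s_right.1 linearD tensDr scalerDl scalerDr.
  by rewrite opprD addrACA.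
- rewrite -s_right.2 epsZ mul1r scalerBr !scalerA tens_comm.
  by rewrite (tensM 1 b 1) mulr1.
- rewrite -s_right.1 linearD tensDr scalerDl pairingDr //.
  by rewrite !opprD addrACA.
rewrite -s_right.2 epsZ mul1r scalerBr scalerN !scalerA.
by rewrite tensM mul1r pairingZr.
Qed.

Lemma hty_dD i q : {morph (@hty_d i)^~ q : p p' / p + p'}.
Proof.
case: i => [|i] p p' /=; first by rewrite addr0.
by rewrite linearD pairingDl //; apply: hty_right.
Qed.

Lemma hty_dZ i a b (p : Fr i) q :
  hty_d (tens a b *: p) q = tens a 1 *: hty_d p (tens b 1 *: q).
Proof.
case: i p => [|i] p /=; first by rewrite scaler0.
by rewrite linearZ /= pairingZ //; apply: hty_right.
Qed.

Lemma eps_pairing i (p : Fr i) q : eps (pairing (@hty i) p q) = 0.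
Proof.
have R := @hty_right i.
move: p; apply: bimodule_eq => [||u v x].
- exact: (morphD_comp (linear_morphD eps) (pairingDl R q)).
- exact: morphD_cst0.
by rewrite pairingU // linearZ /= htyE eps_s scaler0.
Qed.

Lemma eps_hty_d i (p : Fr i) q : eps (hty_d p q) = 0.
Proof. by case: i p => [|i] p /=; rewrite ?linear0 ?eps_pairing. Qed.

Lemma pairing_homotopy_from i (p : Fr i) q :
  (forall (x : X i) (q' : E), let psi q := tens (eps_lvl (gen Ae x)) 1 *: q
     - tens 1 (eps q) *: inj (gen Ae x) - hty_d (gen Ae x) q in
     psi (dT q') = sg i (dT (psi q'))) ->
  dT (pairing (@hty i) p q) + hty_d p q + sg i (pairing (@hty i) p (dT q)) =
  tens (eps_lvl p) 1 *: q - tens 1 (eps q) *: inj p.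
Proof.
move=> psi_d; have R := @hty_right i.
have on_gen (x : X i) q' :
    dT (hty x q') + hty_d (gen Ae x) q' + sg i (hty x (dT q')) =
    tens (eps_lvl (gen Ae x)) 1 *: q' - tens 1 (eps q') *: inj (gen Ae x).
  rewrite !htyE psi_d (morph_sg _ _ s_right.1) sgK s_contr.
  set psi := _ - hty_d _ q'.
  have -> : eps psi = 0.
    rewrite /psi !linearB /= eps_hty_d subr0 !epsZ eps_lvlE mul1r mulr1.
    by rewrite subrr.
  by rewrite tens0r scale0r subr0 addrAC subrK /psi subrK.
move: p; apply: bimodule_eq => [||u v x].
- apply: (morphD_add (morphD_add _ (hty_dD q))).
    exact: (morphD_comp (linear_morphD dT) (pairingDl R q)).
  exact: (morphD_comp (sgD i) (pairingDl R _)).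
- apply: morphD_sub.
    by move=> p p'; rewrite !eps_lvlE linearD linearD tensDl scalerDl.
  exact: (morphD_comp (scale_morphD _) (linear_morphD (@inj i))).
have := congr1 ( *:%R (tens u 1)) (on_gen x (tens v 1 *: q)).
rewrite dTZ !pairingU // -scale_gen hty_dZ !eps_lvlE injZ dTZ.
rewrite scalerDr scalerDr (morph_sg _ _ (scale_morphD (tens u 1))) => ->.
rewrite !epsZ mulr1 scalerBr !scalerA !tensM !mulr1 !mul1r.
by rewrite mulrA.
Qed.

Lemma pairing_homotopy i (p : Fr i) q :
  dT (pairing (@hty i) p q) + hty_d p q + sg i (pairing (@hty i) p (dT q)) =
  tens (eps_lvl p) 1 *: q - tens 1 (eps q) *: inj p.
Proof.
elim: i p q => [|i IH] p q.
  apply: pairing_homotopy_from => x {}q /=; rewrite eps_dT tens0r scale0r !subr0.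
  by rewrite (morphDB (linear_morphD dT)) !dTZ dT0 scaler0 subr0.
apply: pairing_homotopy_from => {p} x {}q /=.
rewrite eps_dT tens0r tens0l !scale0r ?subr0 !sub0r ?oppr0 ?add0r.
rewrite (morphDB (linear_morphD dT)) (morphDN (linear_morphD dT)) dTZ dTS.
rewrite !free_lift_gen.
have -> : dT (pairing (@hty i) (d x) q) =
    - (tens 1 (eps q) *: inj (d x)) - sg i (pairing (@hty i) (d x) (dT q)).
  have := IH (d x) q.
  have -> : hty_d (d x) q = 0.
    case: i IH x => [|i] IH x //=; rewrite -[d x]free_lift_gen dd0.
    by rewrite (morphD0 (pairingDl (@hty_right i) _)).
  have -> : eps_lvl (d x) = 0.
    by rewrite eps_lvlE -[d x]free_lift_gen -dTS eps_dT.
  by rewrite tens0l scale0r sub0r addr0 => <-; rewrite addrK.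
by rewrite opprB addrC subrK sgS sgK.
Qed.

(** ** Twisted chains with coefficients in the resolution *)

Variables (mu : {lrmorphism A -> A}) (phi : E -> E) (Theta : E -> A).
Hypotheses (phiD : {morph phi : p q / p + q})
  (phiZ : forall a b p, phi (tens a b *: p) = tens (mu a) (mu b) *: phi p)
  (phi_d : forall p, phi (dT p) = dT (phi p))
  (eps_phi : forall p, eps (phi p) = mu (eps p) :> A)
  (ThetaD : {morph Theta : p q / p + q})
  (Theta_trace : forall a p, Theta (tens a 1 *: p) = Theta (tens 1 (mu a) *: p))
  (Theta_d : forall p, Theta (dT p) = 0).

Definition twist : Ae -> Ae := elift (fun u v => tens v (mu u)).

Let twist_bil : (forall v, linear (fun u => tens v (mu u) : Ae)) /\
  (forall u : A, linear (fun v => tens v (mu u) : Ae)).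
Proof.
split=> [v c a b|u c a b]; first by rewrite linearP tensDr tensZr.
by rewrite tensDl tensZl.
Qed.

Lemma twistD : {morph twist : t u / t + u}. Proof. exact: eliftD. Qed.

Lemma twist_tens u v : twist (tens u v) = tens v (mu u).
Proof. exact: elift_tens. Qed.

Lemma twistM t u : twist (t * u) = twist u * twist t.
Proof.
elim/Aenv_ind: t => [|t t' ht ht'|a b].
- by rewrite mul0r (morphD0 twistD) mulr0.
- by rewrite mulrDl !twistD ht ht' mulrDr.
elim/Aenv_ind: u => [|u u' hu hu'|a' b'].
- by rewrite mulr0 (morphD0 twistD) mul0r.
- by rewrite mulrDr !twistD hu hu' mulrDl.
by rewrite tensM !twist_tens tensM rmorphM.
Qed.

Local Notation C i := {malg E[X i]}.

(** The class of [p \otimes q] among the chains [C i], which are the quotient of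
    the tensor product over [A] of [Fr i] and [E] by the relations
    [a p \otimes q = p \otimes q mu(a)]. *)
Definition box i (p : Fr i) (q : E) : C i :=
  mlift (fun y t => << twist t *: q *g y >>) p.

Let boxT i q (y : X i) : {morph (fun t => << twist t *: q *g y >> : C i) : t u / t + u}.
Proof. by move=> t u; rewrite twistD scalerDl monalgUD. Qed.

Lemma boxDl i q : {morph (@box i)^~ q : p p' / p + p'}.
Proof. by apply: mliftD => y; apply: boxT. Qed.

Lemma boxU i t (y : X i) q : box << t *g y >> q = << twist t *: q *g y >>.
Proof. by rewrite /box mliftU // => z; apply: (morphD0 (boxT q z)). Qed.

Lemma boxE i (p : Fr i) q y : (box p q)@_y = twist p@_y *: q.
Proof.
move: p; apply: malg_morph_eq => [||x t].
- exact: (morphD_comp (mcoeffD y) (boxDl q)).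
- by move=> p p'; rewrite mcoeffD twistD scalerDl.
by rewrite boxU !mcoeffU; case: eqP; rewrite // !mulr0n (morphD0 twistD) scale0r.
Qed.

Lemma boxDr i (p : Fr i) : {morph box p : q q' / q + q'}.
Proof. by move=> q q'; apply/malgP => y; rewrite mcoeffD !boxE scalerDr. Qed.

Lemma boxZ i t (p : Fr i) q : box (t *: p) q = box p (twist t *: q).
Proof. by apply/malgP => y; rewrite !boxE mcoeffZ twistM scalerA. Qed.

Definition dh i (w : C i.+1) : C i := mlift (fun x q => box (d x) q) w.

Lemma dhD i : {morph @dh i : v w / v + w}.
Proof. by apply: mliftD => x; apply: boxDr. Qed.

Lemma dhU i q x : @dh i << q *g x >> = box (d x) q.
Proof. by rewrite /dh mliftU // => y; apply: (morphD0 (boxDr _)). Qed.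

Lemma dh_box i (p : Fr i.+1) q : dh (box p q) = box (D i p) q.
Proof.
move: p; apply: malg_morph_eq => [||x t].
- exact: (morphD_comp (@dhD i) (boxDl q)).
- exact: (morphD_comp (boxDl q) (linear_morphD (D i))).
by rewrite boxU dhU -scale_gen linearZ /= free_lift_gen boxZ.
Qed.

Lemma dh_dh i (w : C i.+2) : dh (dh w) = 0.
Proof.
move: w; apply: malg_morph_eq => [||x q].
- exact: (morphD_comp (@dhD _) (@dhD _)).
- exact: morphD_cst0.
by rewrite dhU dh_box -[d x]free_lift_gen dd0 (morphD0 (boxDl q)).
Qed.

Lemma dh_cmap i (f : {linear E -> E}) (w : C i.+1) :
  dh (cmap f w) = cmap f (dh w).
Proof.
have fD := linear_morphD f.
move: w; apply: malg_morph_eq => [||x q].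
- by move=> v w; rewrite cmapD // dhD.
- by move=> v w; rewrite dhD cmapD.
rewrite cmapU // !dhU; apply/malgP => y.
by rewrite cmapE // !boxE linearZ.
Qed.

Lemma eps_dh_s i (w : C i.+1) y : eps (dh (cmap s w))@_y = 0.
Proof.
have sD := s_right.1.
move: w; apply: malg_morph_eq => [||x q].
- apply: (morphD_comp (linear_morphD eps)); apply: (morphD_comp (mcoeffD y)).
  by move=> v v'; rewrite cmapD // dhD.
- exact: morphD_cst0.
by rewrite cmapU // dhU boxE linearZ /= eps_s scaler0.
Qed.

(** The condition for [w] to extend to a cycle of the double complex of twisted
    chains by elements of the [C j] with [j < i]; the extension is built with
    the contraction [s], and [left_end] is its component in [C 0]. *)
Definition extendable i : C i -> Prop :=
  match i return C i -> Prop with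
  | 0 => fun=> True
  | j.+1 => fun w => dh (cmap dT w) = 0 /\ forall y, eps (dh w)@_y = 0
  end.

(** The sign accumulates those of the vertical differentials that are
    crossed. *)
Fixpoint left_end i : C i -> C 0%N :=
  match i return C i -> C 0%N with
  | 0 => id
  | j.+1 => fun w => sg j.+1 (left_end (cmap s (dh w)))
  end.

Lemma extendable_step i (w : C i.+1) : extendable w ->
  extendable (cmap s (dh w)) /\ cmap dT (cmap s (dh w)) = dh w.
Proof.
move=> [dw ew]; have sD := s_right.1.
have ds : cmap dT (cmap s (dh w)) = dh w.
  apply/malgP => y; rewrite !cmapE //; try exact: linearD.
  rewrite s_contr ew tens0r scale0r subr0.
  have -> : dT (dh w)@_y = 0.
    rewrite -(@cmapE _ _ _ dT) -?dh_cmap ?dw ?mcoeff0 //; exact: linearD.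
  by rewrite (morphD0 sD) subr0.
split=> //; case: i w dw ew ds => [|i] w dw ew ds //.
by split=> [|y]; rewrite ?ds ?dh_dh ?eps_dh_s.
Qed.

(** A family of functionals whose coboundary on the double complex is [e], up to
    the correction [L] on the left edge. Summed over the extension of [w] to a
    cycle, only the two ends contribute, because [e] vanishes on the image of
    the contraction. *)
Lemma telescope_cycle (kap e : forall i, C i -> A) (L : C 0%N -> A) :
  (forall i, {morph @kap i : v w / v + w}) -> {morph L : v w / v + w} ->
  (forall w, kap 0%N (cmap dT w) = e 0%N w - L w) ->
  (forall i (w : C i.+1), kap i (dh w) + sg i.+1 (kap i.+1 (cmap dT w)) = e i.+1 w) ->
  (forall i (w : C i), e i (cmap s w) = 0) ->
  forall i (w : C i), extendable w ->
    sg i (kap i (cmap dT w)) = e i w - L (left_end w).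
Proof.
move=> kD LD k0 kS es; elim=> [|i IH] w wx /=; first by rewrite k0.
have [wx' dw'] := extendable_step wx.
have := IH _ wx'; rewrite dw' es sub0r => kE.
rewrite -(kS i w) -[kap i (dh w)](sgK i) kE.
rewrite (morph_sg _ _ LD) (sgS i (L _)) opprK.
rewrite -(morph_sg i (L _) (@opprD A)) addrAC addNr.
by rewrite add0r.
Qed.

Definition ev i (f : X i -> E -> A) (w : C i) : A := mlift f w.

Lemma evD i (f : X i -> E -> A) : (forall x, {morph f x : p q / p + q}) ->
  {morph ev f : v w / v + w}.
Proof. exact: mliftD. Qed.

Lemma evU i (f : X i -> E -> A) q x : (forall x, {morph f x : p q / p + q}) ->
  ev f << q *g x >> = f x q.
Proof. by move=> fD; rewrite /ev mliftU // => y; apply: (morphD0 (fD y)). Qed.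

(** ** The first homotopy *)

Definition ev_hty i := ev (fun (x : X i) q => Theta (hty x q)).
Definition ev_right i := ev (fun (x : X i) q => Theta (tens 1 (eps q) *: inj (gen Ae x))).
Definition ev_left := ev (fun (x : X 0%N) q => Theta (tens (eps0 (gen Ae x)) 1 *: q)).

Let hty_morph i (x : X i) : {morph (fun q => Theta (hty x q)) : p q / p + q}.
Proof. by move=> p q; rewrite (hty_right x).1 ThetaD. Qed.

Let right_morph i (x : X i) :
  {morph (fun q => Theta (tens 1 (eps q) *: inj (gen Ae x))) : p q / p + q}.
Proof. by move=> p q; rewrite linearD tensDr scalerDl ThetaD. Qed.

Let left_morph (x : X 0%N) :
  {morph (fun q => Theta (tens (eps0 (gen Ae x)) 1 *: q)) : p q / p + q}.
Proof. by move=> p q; rewrite scalerDr ThetaD. Qed.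

Lemma ev_hty_box i (p : Fr i) q : ev_hty (box p q) = Theta (pairing (@hty i) p q).
Proof.
have R := @hty_right i; have eD := evD (@hty_morph i).
move: p; apply: bimodule_eq => [||u v x].
- exact: (morphD_comp eD (boxDl q)).
- exact: (morphD_comp ThetaD (pairingDl R q)).
rewrite boxU /ev_hty evU // twist_tens pairingU // Theta_trace -(hty_right x).2.
by rewrite scalerA tensM !mul1r.
Qed.

Lemma ev_hty_cycle i (w : C i) : extendable w ->
  sg i (ev_hty (cmap dT w)) = - ev_right w + ev_left (left_end w).
Proof.
have dD := linear_morphD dT.
have := @telescope_cycle ev_hty (fun i w => - ev_right w) (fun w => - ev_left w).
move=> T wx; rewrite T ?opprK // => {i w wx T}.
- by move=> i; apply: evD.
- by move=> v w; rewrite /ev_left evD // opprD.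
- rewrite /ev_hty /ev_right /ev_left.
  apply: malg_morph_eq => [v w|v w|x q]; first by rewrite cmapD // evD.
    by rewrite !evD // !opprD !opprK addrACA.
  rewrite cmapU // !evU // opprK.
  have := congr1 Theta (pairing_homotopy (gen Ae x) q).
  rewrite /= addr0 !ThetaD Theta_d add0r pairing_gen; last exact: hty_right.
  by rewrite (morphDN ThetaD) => ->; rewrite addrC.
- move=> i; rewrite /ev_hty /ev_right.
  apply: malg_morph_eq => [v w|v w|x q].
  + by rewrite cmapD // dhD !evD // sgD addrACA.
  + by rewrite evD // opprD.
  rewrite dhU cmapU // -/(ev_hty _) ev_hty_box !evU //.
  have := congr1 Theta (pairing_homotopy (gen Ae x) q).
  rewrite pairing_gen; last exact: hty_right.
  rewrite pairing_gen; last exact: hty_right.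
  rewrite /= free_lift_gen !ThetaD Theta_d add0r tens0l scale0r (morphD0 ThetaD).
  by rewrite add0r (morphDN ThetaD) (morph_sg _ _ ThetaD).
move=> i; have sD := s_right.1; rewrite /ev_right.
move=> w; apply/eqP; rewrite oppr_eq0; apply/eqP; move: w.
apply: malg_morph_eq => [v w|v w|x q]; rewrite ?addr0 //.
  by rewrite cmapD // evD.
by rewrite cmapU // evU // eps_s tens0r scale0r (morphD0 ThetaD).
Qed.

(** ** The rotated homotopy

    Exchanging the two factors of the tensor square, with the semilinear map
    [phi] applied to the factor that crosses the twist, turns the homotopy
    into one that relates [phi] to the identity. *)
Fact hty_total_ex q : exists2 h : E -> E, {morph h : p p' / p + p'} &
  forall i (p : Fr i), h (inj p) = pairing (@hty i) p q.
Proof. by apply: E_ext => i; apply: pairingDl; apply: hty_right. Qed.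

Definition hty_total (p q : E) : E := s2val (cid2 (hty_total_ex q)) p.

Lemma hty_totalDl q : {morph hty_total^~ q : p p' / p + p'}.
Proof. exact: (s2valP (cid2 (hty_total_ex q))). Qed.

Lemma hty_total_inj i (p : Fr i) q : hty_total (inj p) q = pairing (@hty i) p q.
Proof. exact: (s2valP' (cid2 (hty_total_ex q))). Qed.

Lemma hty_totalDr p : {morph hty_total p : q q' / q + q'}.
Proof.
move=> q q'; move: p; apply: E_eq => [||i p].
- exact: hty_totalDl.
- exact: (morphD_add (hty_totalDl q) (hty_totalDl q')).
by rewrite !hty_total_inj; apply: pairingDr; apply: hty_right.
Qed.

Lemma hty_totalZr b p q : hty_total p (tens 1 b *: q) = tens 1 b *: hty_total p q.
Proof.
move: p; apply: E_eq => [||i p].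
- exact: hty_totalDl.
- exact: (morphD_comp (scale_morphD _) (hty_totalDl q)).
by rewrite !hty_total_inj; apply: pairingZr; apply: hty_right.
Qed.

Lemma hty_totalZl a p q : hty_total (tens a 1 *: p) q = tens a 1 *: hty_total p q.
Proof.
move: p; apply: E_eq => [||i p].
- exact: (morphD_comp (hty_totalDl q) (scale_morphD _)).
- exact: (morphD_comp (scale_morphD _) (hty_totalDl q)).
have -> : tens a 1 *: inj p = inj (tens a 1 *: p) by rewrite linearZ.
by rewrite !hty_total_inj; apply: pairingZl; apply: hty_right.
Qed.

Lemma hty_total_balanced b p q :
  hty_total (tens 1 b *: p) q = hty_total p (tens b 1 *: q).
Proof.
move: p; apply: E_eq => [||i p].
- exact: (morphD_comp (hty_totalDl q) (scale_morphD _)).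
- exact: hty_totalDl.
have -> : tens 1 b *: inj p = inj (tens 1 b *: p) by rewrite linearZ.
by rewrite !hty_total_inj; apply: pairing_balanced; apply: hty_right.
Qed.

Variable sgn : {linear E -> E}.
Hypothesis sgn_inj : forall i (p : Fr i), sgn (inj p) = sg i (inj p).

Lemma sgn_sgn p : sgn (sgn p) = p.
Proof.
move: p; apply: E_eq => [||i p].
- exact: (morphD_comp (linear_morphD sgn) (linear_morphD sgn)).
- by [].
by rewrite sgn_inj (morph_sg _ _ (linear_morphD sgn)) sgn_inj sgK.
Qed.

Lemma dT_sgn p : dT (sgn p) = - sgn (dT p).
Proof.
move: p; apply: E_eq => [||i p].
- exact: (morphD_comp (linear_morphD dT) (linear_morphD sgn)).
- apply: (morphD_comp (@opprD _)).
  exact: (morphD_comp (linear_morphD sgn) (linear_morphD dT)).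
rewrite sgn_inj (morph_sg _ _ (linear_morphD dT)).
case: i p => [|i] p; first by rewrite dT0 linear0 oppr0.
by rewrite dTS sgn_inj sgS.
Qed.

Lemma eps_sgn p : eps (sgn p) = eps p.
Proof.
move: p; apply: E_eq => [||[|i] p].
- exact: (morphD_comp (linear_morphD eps) (linear_morphD sgn)).
- exact: linear_morphD.
- by rewrite sgn_inj.
by rewrite sgn_inj (morph_sg _ _ (linear_morphD eps)) eps_S /sg oppr0 if_same.
Qed.

Lemma hty_total_homotopy q p :
  dT (hty_total q p) + hty_total (dT q) p + hty_total (sgn q) (dT p) =
  tens (eps q) 1 *: p - tens 1 (eps p) *: q.
Proof.
move: q; apply: E_eq => [||i q].
- apply: morphD_add; last exact: (morphD_comp (hty_totalDl _) (linear_morphD sgn)).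
  apply: morphD_add; last exact: (morphD_comp (hty_totalDl _) (linear_morphD dT)).
  exact: (morphD_comp (linear_morphD dT) (hty_totalDl _)).
- apply: morphD_sub; last exact: scale_morphD.
  by move=> q q'; rewrite linearD tensDl scalerDl.
rewrite sgn_inj (morph_sg _ _ (hty_totalDl _)) !hty_total_inj.
rewrite -eps_lvlE -pairing_homotopy; congr (_ + _ + _).
case: i q => [|i] q /=; first by rewrite dT0 (morphD0 (hty_totalDl _)).
by rewrite dTS hty_total_inj.
Qed.

Definition sgn_pow (i : nat) (q : E) : E := if odd i then sgn q else q.

Lemma sgn_powD i : {morph sgn_pow i : p q / p + q}.
Proof. by move=> p q; rewrite /sgn_pow; case: odd => //; rewrite linearD. Qed.

Lemma sgn_powZ i t q : sgn_pow i (t *: q) = t *: sgn_pow i q.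
Proof. by rewrite /sgn_pow; case: odd => //; rewrite linearZ. Qed.

Lemma sgn_pow_sgn i q : sgn (sgn_pow i.+1 q) = sgn_pow i q.
Proof. by rewrite /sgn_pow /=; case: odd => //=; rewrite sgn_sgn. Qed.

Lemma dT_sgn_pow i q : dT (sgn_pow i q) = sg i (sgn_pow i (dT q)).
Proof. by rewrite /sgn_pow /sg; case: odd => //; rewrite dT_sgn. Qed.

Lemma eps_sgn_pow i q : eps (sgn_pow i q) = eps q.
Proof. by rewrite /sgn_pow; case: odd => //; rewrite eps_sgn. Qed.

Definition ev_rot i :=
  ev (fun (x : X i) q => Theta (hty_total (sgn_pow i q) (phi (inj (gen Ae x))))).
Definition ev_phi i :=
  ev (fun (x : X i) q => Theta (tens (eps q) 1 *: phi (inj (gen Ae x)))).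

Let rot_morph i (x : X i) : {morph (fun q =>
  Theta (hty_total (sgn_pow i q) (phi (inj (gen Ae x))))) : p q / p + q}.
Proof. by move=> p q; rewrite sgn_powD hty_totalDl ThetaD. Qed.

Let phi_morph i (x : X i) : {morph (fun q =>
  Theta (tens (eps q) 1 *: phi (inj (gen Ae x)))) : p q / p + q}.
Proof. by move=> p q; rewrite linearD tensDl scalerDl ThetaD. Qed.

Lemma ev_rot_box i (p : Fr i) q :
  ev_rot (box p q) = Theta (hty_total (sgn_pow i q) (phi (inj p))).
Proof.
have eD := evD (@rot_morph i).
move: p; apply: bimodule_eq => [||u v x].
- exact: (morphD_comp eD (boxDl q)).
- apply: (morphD_comp ThetaD); apply: (morphD_comp (hty_totalDr _)).
  exact: (morphD_comp phiD (linear_morphD (@inj i))).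
rewrite boxU /ev_rot evU // twist_tens -scale_gen linearZ.
rewrite phiZ (tensE' (mu u)) -scalerA.
rewrite hty_totalZr -Theta_trace -hty_totalZl -hty_total_balanced.
by rewrite sgn_powZ scalerA -tensE'.
Qed.

Lemma ev_rot_cycle i (w : C i) : extendable w ->
  sg i (ev_rot (cmap dT w)) = ev_phi w - ev_left (left_end w).
Proof.
have dD := linear_morphD dT.
have key j (x : X j) q : Theta (hty_total (sgn_pow j.+1 q) (phi (dT (inj (gen Ae x))))) +
    sg j (Theta (hty_total (sgn_pow j (dT q)) (phi (inj (gen Ae x))))) =
    Theta (tens (eps q) 1 *: phi (inj (gen Ae x)))
    - Theta (tens (eps (inj (gen Ae x))) 1 *: sgn_pow j q).
  have := congr1 Theta (hty_total_homotopy (sgn_pow j q) (phi (inj (gen Ae x)))).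
  rewrite dT_sgn_pow eps_sgn_pow eps_phi (morph_sg _ _ (hty_totalDl _)) -phi_d.
  rewrite !ThetaD Theta_d add0r (morphDN ThetaD) -Theta_trace (morph_sg _ _ ThetaD).
  rewrite addrC -[sgn_pow j.+1 q]sgn_sgn sgn_pow_sgn => <-.
  by [].
have := @telescope_cycle ev_rot ev_phi ev_left.
move=> T wx; rewrite T // => {i w wx T}.
- by move=> i; apply: evD.
- by apply: evD.
- rewrite /ev_rot /ev_phi /ev_left.
  apply: malg_morph_eq => [v w|v w|x q]; first by rewrite cmapD // evD.
    by rewrite !evD // opprD addrACA.
  rewrite cmapU // !evU //; have := key 0%N x q.
  by rewrite dT0 (morphD0 phiD) (morphD0 (hty_totalDr _)) (morphD0 ThetaD) add0r eps_0.
- move=> i; rewrite /ev_rot /ev_phi.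
  apply: malg_morph_eq => [v w|v w|x q].
  + by rewrite cmapD // dhD !evD // sgD addrACA.
  + by rewrite evD.
  rewrite dhU cmapU // -/(ev_rot _) ev_rot_box !evU //.
  have := key i.+1 x q; rewrite eps_S tens0l scale0r (morphD0 ThetaD) subr0 => <-.
  rewrite dTS free_lift_gen; congr (Theta (hty_total _ _) + _).
  by rewrite /sgn_pow /=; case: odd.
move=> i; have sD := s_right.1; rewrite /ev_phi.
apply: malg_morph_eq => [v w|v w|x q]; rewrite ?addr0 //.
  by rewrite cmapD // evD.
by rewrite cmapU // evU // eps_s tens0l scale0r (morphD0 ThetaD).
Qed.

(** For a twisted cycle [x a], rotating once around the circle applies [phi],
    and both positions are homologous to the left end of the extension. *)
Lemma rotation i (x : X i) (a : A) :
  extendable << tens a 1 *: p0 *g x >> ->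
  Theta (phi (tens 1 a *: inj (gen Ae x))) = Theta (tens 1 a *: inj (gen Ae x)).
Proof.
have dD := linear_morphD dT.
move=> wx; have E1 := ev_hty_cycle wx; have E2 := ev_rot_cycle wx.
have dp : dT (tens a 1 *: p0) = 0 by rewrite linearZ /= d_p0 scaler0.
have ea : eps (tens a 1 *: p0) = a :> A by rewrite epsZ eps_p0 !mulr1.
rewrite cmapU // dp monalgU0 in E1 E2.
rewrite /ev_hty /ev_rot (morphD0 (evD _)) // in E1.
rewrite /ev_rot (morphD0 (evD _)) // in E2.
rewrite /sg oppr0 if_same in E1 E2.
move/esym/eqP: E1; rewrite addrC subr_eq0 => /eqP E1.
move/esym/eqP: E2; rewrite subr_eq0 E1 => /eqP.
rewrite /ev_phi /ev_right !evU // ea => <-.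
by rewrite phiZ rmorph1 Theta_trace.
Qed.
End Rotation.

Section TwistedCycles.
Variables (k : fieldType) (A : algType k) (G : connected_grading A).
Local Notation Ae := (Aenv A).
Variables (X : nat -> choiceType) (d : forall i, X i.+1 -> {malg Ae[X i]})
  (aug : X 0%N -> Abim A).
Hypothesis F : minimal_free_resolution (env_grading G) d aug.
Local Notation Fr i := {malg Ae[X i]}.
Local Notation D i := (free_lift (@d i)).
Local Notation eps0 := (free_lift aug).
Variable mu : {lrmorphism A -> A}.

(** The class [v a mu(u)] of [u \otimes v] in [A^e] tensored over [A^e] with the
    twisted bimodule, translated by [a]. *)
Definition twisted_class (a : A) : Ae -> A := elift (fun u v => v * a * mu u).

Let class_bil a : (forall v, linear (fun u => v * a * mu u)) /\
  (forall u : A, linear (fun v => v * a * mu u)).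
Proof.
split=> [v c u u'|u c v v']; first by rewrite linearP mulrDr scalerAr.
by rewrite !mulrDl -!scalerAl.
Qed.

Lemma twisted_classD a : {morph twisted_class a : t u / t + u}.
Proof. exact: eliftD. Qed.

Lemma twisted_class_tens a u v : twisted_class a (tens u v) = v * a * mu u.
Proof. exact: elift_tens. Qed.

Lemma twisted_classZ a (c : k) t : twisted_class a (c *: t) = c *: twisted_class a t.
Proof. exact: eliftZ. Qed.

Lemma twisted_class_trace b t :
  twisted_class 1 (tens b 1 * t) = twisted_class 1 (tens 1 (mu b) * t).
Proof.
elim/Aenv_ind: t => [|t u ht hu|u v]; first by rewrite !mulr0.
  by rewrite !mulrDr !twisted_classD ht hu.
by rewrite !tensM !twisted_class_tens mul1r mulr1 rmorphM !mulr1 mulrA.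
Qed.

Lemma twisted_class_mul a t : twisted_class 1 (tens 1 a * t) = twisted_class a t.
Proof.
elim/Aenv_ind: t => [|t u ht hu|u v].
- by rewrite mulr0 !(morphD0 (twisted_classD _)).
- by rewrite mulrDr !twisted_classD ht hu.
by rewrite !tensM !twisted_class_tens mul1r mulr1.
Qed.

(** [x a] is a cycle of the complex of twisted coinvariants. *)
Definition twisted_cycle n : X n -> A -> Prop :=
  match n return X n -> A -> Prop with
  | 0 => fun _ _ => True
  | j.+1 => fun x a => forall y, twisted_class a (d x)@_y = 0
  end.

(** A twisted trace sees the coefficients of the differential of [x a] only
    through their twisted classes. *)
Lemma twisted_trace_d j (L : Fr j -> A) (x : X j.+1) a :
  {morph L : p q / p + q} ->
  (forall b p, L (tens b 1 *: p) = L (tens 1 (mu b) *: p)) ->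
  twisted_cycle x a -> L (D j (tens 1 a *: gen Ae x)) = 0.
Proof.
move=> LD Lt cyc; rewrite free_liftZ free_lift_gen [d x]malg_gens scaler_sumr.
rewrite (morphD_sum LD) big1 // => y _; rewrite scalerA.
have LE t : L ((tens 1 a * t) *: gen Ae y) = L (tens 1 (twisted_class a t) *: gen Ae y).
  move: t; apply: Aenv_morph_eq => [t u|t u|u v].
  - by rewrite mulrDr scalerDl LD.
  - by rewrite twisted_classD tensDr scalerDl LD.
  rewrite twisted_class_tens (tensM 1 a u v) mul1r (tensE u) -scalerA Lt scalerA.
  by rewrite (tensM 1 (mu u)) mul1r.
by rewrite LE cyc tens0r scale0r (morphD0 LD).
Qed.

(** The maps of [rotation] are assembled from their components, and [Theta] is
    extended by zero to the other degrees. *)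
Lemma twisted_cycle_invariant n (x : X n) a
    (phi : forall i, Fr i -> Fr i) (Theta : Fr n -> A) :
  (forall i, {morph @phi i : p q / p + q}) ->
  (forall i b c (p : Fr i), phi i (tens b c *: p) = tens (mu b) (mu c) *: phi i p) ->
  (forall i p, phi i (D i p) = D i (phi i.+1 p)) ->
  (forall p, eps0 (phi 0%N p) = mu (eps0 p) :> A) ->
  {morph Theta : p q / p + q} ->
  (forall b p, Theta (tens b 1 *: p) = Theta (tens 1 (mu b) *: p)) ->
  (forall p, Theta (D n p) = 0) ->
  twisted_cycle x a ->
  Theta (phi n (tens 1 a *: gen Ae x)) = Theta (tens 1 a *: gen Ae x).
Proof.
move=> phiD phiZ phi_d phi_eps ThD Tht Thd cyc.
have [q0 [s [q0E sR s0E sE]]] := contraction F.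
have [E [inj [E_eq E_ext]]] := direct_sum_exists A X.
have linear_ext (N : lmodType Ae) (f : forall i, Fr i -> N) : (forall i, linear (@f i)) ->
    exists h : {linear E -> N}, forall i p, h (inj i p) = f i p.
  move=> fL; have fD i : {morph @f i : p q / p + q}.
    by move=> p q; have := fL i 1 p q; rewrite !scale1r.
  have [h hD hE] := E_ext N f fD.
  have [|h' h'E] := @linear_of _ E N h.
    move=> t p q; rewrite hD; congr (_ + _); move: p; apply: E_eq => [||i p].
    - exact: (morphD_comp hD (scale_morphD t)).
    - exact: (morphD_comp (scale_morphD t) hD).
    rewrite -linearZ !hE; have := fL i t p 0.
    by rewrite addr0 (morphD0 (fD i)) addr0.
  by exists h' => i p; rewrite h'E hE.
have [dT dTE] := linear_ext E (fun i => match i return Fr i -> E with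
    | 0 => fun=> 0 | j.+1 => fun p => inj j (D j p) end) ltac:(
  by case=> [|i] t p q; rewrite ?scaler0 ?addr0 // !linearP).
have [eps epsE] := linear_ext (Abim A) (fun i => match i return Fr i -> Abim A with
    | 0 => fun p => eps0 p | _ => fun=> 0 end) ltac:(
  by case=> [|i] t p q; rewrite ?scaler0 ?addr0 // linearP).
have [|sgn sgnE] := linear_ext E (fun i p => sg i (inj i p)).
  move=> i t p q; rewrite linearP sgD; congr (_ + _).
  exact/esym/(morph_sg _ _ (scale_morphD t)).
have sD i : {morph (fun p => inj i.+1 (s i p)) : p q / p + q}.
  exact: (morphD_comp (linear_morphD (inj i.+1)) (sR i).1).
have [sT sTD sTE] := E_ext E (fun i p => inj i.+1 (s i p)) sD.
have sT_right : right_linear sT.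
  split=> // b; apply: E_eq => [||i p].
  - exact: (morphD_comp sTD (scale_morphD _)).
  - exact: (morphD_comp (scale_morphD _) sTD).
  by rewrite -linearZ !sTE (sR i).2 linearZ.
have phD i : {morph (fun p => inj i (phi i p)) : p q / p + q}.
  exact: (morphD_comp (linear_morphD (inj i)) (@phiD i)).
have [ph phTD phE] := E_ext E (fun i p => inj i (phi i p)) phD.
pose TL i (p : Fr i) : A :=
  if i =P n is ReflectT e then Theta (eq_rect i (fun j => Fr j) p n e) else 0.
have TLn p : TL n p = Theta p.
  by rewrite /TL; case: eqP => // e; rewrite (eq_axiomK e).
have TL0 i p : i <> n -> TL i p = 0.
  by rewrite /TL; case: eqP.
have TLD i : {morph @TL i : p q / p + q}.
  move=> p q; have [e|ne] := i =P n; last by rewrite !TL0 // addr0.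
  by subst i; rewrite !TLn ThD.
have [Th ThTD ThE] := E_ext A TL TLD.
rewrite -!TLn -!ThE -phE linearZ.
apply: (@rotation _ _ _ _ _ (@mfr_d_d _ _ _ _ _ _ F) (@mfr_eps_d _ _ _ _ _ _ F) E inj
  E_eq E_ext dT eps sT (inj 0%N q0) _ _ _ _ sT_right _ _ _ _ mu ph Th
  phTD _ _ _ ThTD _ _ sgn sgnE) => //.
- by move=> p; rewrite epsE.
- by move=> i p; rewrite epsE.
- apply: E_eq => [||i p].
  + exact: (morphD_comp (linear_morphD dT) sTD).
  + apply: morphD_sub; last first.
      by move=> p q; rewrite linearD tensDr scalerDl.
    by apply: morphD_sub => //; apply: (morphD_comp sTD (linear_morphD dT)).
  rewrite sTE !dTE epsE; case: i p => [|i] p.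
    by rewrite s0E linearB (morphD0 sTD) subr0 linearZ.
  by rewrite sE linearB sTE tens0r scale0r subr0.
- apply: E_eq => [||i p]; last by rewrite sTE epsE.
  + exact: (morphD_comp (linear_morphD eps) sTD).
  + exact: morphD_cst0.
- by rewrite epsE.
- move=> b c; apply: E_eq => [||i p].
  + exact: (morphD_comp phTD (scale_morphD _)).
  + exact: (morphD_comp (scale_morphD _) phTD).
  by rewrite -linearZ !phE phiZ linearZ.
- apply: E_eq => [||i p].
  + exact: (morphD_comp phTD (linear_morphD dT)).
  + exact: (morphD_comp (linear_morphD dT) phTD).
  rewrite dTE phE dTE; case: i p => [|i] p; first by rewrite (morphD0 phTD).
  by rewrite phE phi_d.
- apply: (E_eq A) => [||i p].
  + exact: (morphD_comp (linear_morphD eps) phTD).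
  + by move=> p q; rewrite linearD rmorphD.
  by rewrite phE !epsE; case: i p => [|i] p; rewrite ?phi_eps ?rmorph0.
- move=> b; apply: E_eq => [||i p].
  + exact: (morphD_comp ThTD (scale_morphD _)).
  + exact: (morphD_comp ThTD (scale_morphD _)).
  have iZ t : t *: inj i p = inj i (t *: p) by rewrite linearZ.
  rewrite (iZ (tens b 1)) (iZ (tens 1 (mu b))) !ThE.
  have [e|ne] := i =P n; last by rewrite !TL0.
  subst i; rewrite (TLn (tens b 1 *: p)) (TLn (tens 1 (mu b) *: p)).
  exact: Tht.
- apply: E_eq => [||i p]; first exact: (morphD_comp ThTD (linear_morphD dT)).
    exact: morphD_cst0.
  rewrite dTE; case: i p => [|i] p; first exact: (morphD0 ThTD).
  rewrite ThE; have [e|ne] := i =P n; last by rewrite TL0.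
  by subst i; rewrite TLn Thd.
case: n x cyc {Theta ThD Tht Thd TL TLn TL0 TLD Th ThTD ThE} => [|j] x cyc //=.
have dq : dT (tens a 1 *: inj 0%N q0) = 0 by rewrite linearZ /= dTE scaler0.
split=> [|y].
  rewrite cmapU; last exact: linear_morphD.
  by rewrite dq monalgU0 (morphD0 (@dhD _ _ _ d _ mu _)).
rewrite dhU boxE -(cyc y); move: (d x)@_y.
have epsZ b c p : eps (tens b c *: p) = b * (eps p : A) * c :> A.
  by rewrite linearZ /= tens_Abim.
apply: Aenv_morph_eq => [t u|t u|u v].
- by rewrite twistD scalerDl linearD.
- exact: twisted_classD.
by rewrite twist_tens twisted_class_tens !epsZ epsE q0E !mulr1.
Qed.
End TwistedCycles.

(** * The homological determinant of the Nakayama automorphism *)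

Section Coboundaries.
Variables (k : fieldType) (A : algType k).
Local Notation Ae := (Aenv A).
Variables (P : resolution (Abim A : lmodType Ae)) (n : nat).

Definition cob (f : P n -> Ae) : Prop :=
  coboundary (P := P) (N := Ae^o%type) f.

Lemma cob_ext f g : f =1 g -> cob f -> cob g.
Proof. by move=> /funext ->. Qed.

Lemma cob0 : cob (fun=> 0).
Proof.
have [h hE] : exists h : {linear P n.-1 -> Ae^o}, forall x, h x = 0.
  by apply: linear_of => t x y; rewrite scaler0 addr0.
rewrite /cob; case: n h hE => [|m] h hE //=.
by exists h => x; rewrite hE.
Qed.

Lemma cobD f g : cob f -> cob g -> cob (fun x => f x + g x).
Proof.
rewrite /cob; case: n f g => [|m] f g /=.
  by move=> f0 g0 x; rewrite f0 g0 addr0.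
move=> [u uE] [v vE]; have [w wE] : exists w : {linear P m -> Ae^o},
    forall x, w x = u x + v x.
  by apply: linear_of => t x y; rewrite !linearP addrACA scalerDr.
by exists w => x; rewrite wE uE vE.
Qed.

Lemma cobM f t : cob f -> cob (fun x => f x * t).
Proof.
rewrite /cob; case: n f => [|m] f /=; first by move=> f0 x; rewrite f0 mul0r.
move=> [u uE]; have [w wE] : exists w : {linear P m -> Ae^o},
    forall x, w x = (u x : Ae) * t.
  by apply: linear_of => c x y; rewrite linearP mulrDl /GRing.scale /= mulrA.
by exists w => x; rewrite wE uE.
Qed.

Lemma cobN f : cob f -> cob (fun x => - f x).
Proof. by move/(cobM (-1)); apply: cob_ext => x; rewrite mulrN1. Qed.

Lemma cobB f g : cob f -> cob g -> cob (fun x => f x - g x).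
Proof. by move=> cf /cobN; apply: cobD. Qed.
End Coboundaries.

Section Main.
Variables (k : fieldType) (A : algType k) (G : connected_grading A) (n : nat)
  (rho : graded_Zaction G) (P : equivariant_resolution rho) (e : cochain P n)
  (e_gen : free_generator e) (eN : Nakayama e (rho 1)).
Local Notation Ae := (Aenv A).
Variables (X : nat -> choiceType) (d : forall i, X i.+1 -> {malg Ae[X i]})
  (aug : X 0%N -> Abim A).
Hypothesis F : minimal_free_resolution (env_grading G) d aug.
Local Notation Q := (free_resolution F).
Local Notation D i := (free_lift (@d i)).
Variables (x0 : X n) (x0_uniq : forall y, y = x0) (n_last : X n.+1 -> False).
Variables (alpha : forall i, {linear Q i -> P i}) (beta : forall i, {linear P i -> Q i})
  (H : forall i, {linear P i -> P i.+1}).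
Hypotheses (alpha_d : chain_map alpha)
  (alpha_aug : forall p, res_aug P (alpha 0%N p) = res_aug Q p)
  (beta_d : chain_map beta)
  (beta_aug : forall p, res_aug Q (beta 0%N p) = res_aug P p)
  (H0 : forall p, res_d P 0%N (H 0%N p) = p - alpha 0%N (beta 0%N p))
  (HS : forall i p, res_d P i.+1 (H i.+1 p) =
    p - alpha i.+1 (beta i.+1 p) - H i (res_d P i p)).

Local Notation tc := (twisted_class (rho 1)).
Local Notation cobP := (@cob k A P n).

Lemma e_lin t p q : e (t *: p + q) = t * e p + e q.
Proof. exact: (fg_cocycle e_gen).1. Qed.

Lemma eD : {morph e : p q / p + q}.
Proof. by move=> p q; have := e_lin 1 p q; rewrite scale1r mul1r. Qed.

Lemma eZ t p : e (t *: p) = t * e p.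
Proof. by have := e_lin t p 0; rewrite addr0 (morphD0 eD) addr0. Qed.

Lemma e_d p : e (res_d P n p) = 0.
Proof. exact: (fg_cocycle e_gen).2. Qed.

(** By the Nakayama relation, the inner action of [A^e] on the class [a e]
    factors through the twisted class. *)
Lemma inner_action a t : cobP (fun p => e p * tens 1 a * t - e p * tens 1 (tc a t)).
Proof.
elim/Aenv_ind: t => [|t u ht hu|u v].
- apply: cob_ext (@cob0 k A P n) => p.
  by rewrite mulr0 (morphD0 (twisted_classD _ _)) tens0r mulr0 subr0.
- apply: cob_ext (cobD ht hu) => p.
  by rewrite twisted_classD tensDr !mulrDr opprD addrACA.
apply: cob_ext (cobM (tens 1 (v * a)) (eN u)) => p.
rewrite /ract /lact mulrBl -!mulrA !tensM !mul1r !mulr1.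
by rewrite twisted_class_tens.
Qed.

Lemma generator_free a : cobP (fun p => e p * tens 1 a) -> a = 0.
Proof.
move=> ca; apply: (fg_free e_gen).
by apply: cob_ext ca => p; rewrite subr0.
Qed.

Lemma last_coeff (p : {malg Ae[X n]}) : p = p@_x0 *: gen Ae x0.
Proof.
rewrite scale_gen; apply/malgP => y; rewrite (x0_uniq y) mcoeffUU.
by [].
Qed.

(** The coefficient function of the last generator is a cocycle, hence a multiple
    of the generator of Ext. *)
Lemma coeff_class : exists a, cobP (fun p => (beta n p : {malg Ae[X n]})@_x0 - e p * tens 1 a).
Proof.
have [|a aE] := fg_gen e_gen (f := fun p => (beta n p : {malg Ae[X n]})@_x0).
  split=> [t p q|p]; first by rewrite linearP mcoeffD mcoeffZ.
  rewrite -beta_d; suff -> : beta n.+1 p = 0 by rewrite linear0 mcoeff0.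
  by apply/malgP => y; case: (n_last y).
by exists a.
Qed.

Section WithClass.
Variable a : A.
Hypothesis a_class : cobP (fun p => (beta n p : {malg Ae[X n]})@_x0 - e p * tens 1 a).

Lemma coeff_mul t : cobP (fun p => (beta n p : {malg Ae[X n]})@_x0 * t - e p * tens 1 (tc a t)).
Proof.
apply: cob_ext (cobD (cobM t a_class) (inner_action a t)) => p.
by rewrite mulrBl addrA subrK.
Qed.

(** [H] is a homotopy between the identity and [alpha \o beta], and [e] is a
    cocycle. *)
Lemma e_homotopy : cobP (fun p => e p - e (alpha n (beta n p))).
Proof.
rewrite /cob; case: n e eD eZ e_d => [|m] f fD fZ f_d /=.
  by move=> p; rewrite -(morphDB fD) -H0 f_d.
have [h hE] : exists h : {linear P m -> Ae^o}, forall p, h p = f (H m p).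
  by apply: linear_of => t p q; rewrite linearP fD fZ.
exists h => p; rewrite hE -(morphDB fD).
have -> : p - alpha m.+1 (beta m.+1 p) = res_d P m.+1 (H m.+1 p) + H m (res_d P m p).
  by rewrite HS subrK.
by rewrite fD f_d add0r.
Qed.

(** For a coefficient [t] of the differential of [x0], the coefficient function
    of [x0] multiplied by [t] is the coefficient function of a generator of the
    previous term composed with the differential. It is also cohomologous to
    [tc a t] times the free generator [e]. *)
Lemma last_twisted_cycle : twisted_cycle d (rho 1) x0 a.
Proof.
have key t : cobP (fun p => (beta n p : {malg Ae[X n]})@_x0 * t) -> tc a t = 0.
  move=> ct; apply: generator_free; apply: cob_ext (cobB ct (coeff_mul t)) => p.
  by rewrite opprB addrC subrK.
move: last_coeff key; rewrite /cob /twisted_cycle; case: n x0 => [|m] x //= xE key y.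
apply: key; have [h hE] : exists h : {linear P m -> Ae^o},
    forall p, h p = (beta m p : {malg Ae[X m]})@_y.
  by apply: linear_of => t p q; rewrite linearP mcoeffD mcoeffZ.
exists h => p; rewrite hE -beta_d.
rewrite [in RHS](xE (beta m.+1 p)) linearZ mcoeffZ /=.
by rewrite free_lift_gen.
Qed.

(** Up to coboundaries, [e] is the coefficient function of [x0] multiplied by
    its value at [x0], which [coeff_mul] expresses in terms of [e] again. *)
Lemma last_class : tc a (e (alpha n (gen Ae x0))) = 1.
Proof.
set t := e _; apply/esym/eqP; rewrite -subr_eq0; apply/eqP.
apply: generator_free; apply: cob_ext (cobD e_homotopy (coeff_mul t)) => p.
have -> : alpha n (beta n p) = (beta n p : {malg Ae[X n]})@_x0 *: alpha n (gen Ae x0).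
  by rewrite [in LHS](last_coeff (beta n p)) linearZ.
by rewrite eZ addrA subrK (morphDB (tensDr 1)) mulrBr tens11 mulr1.
Qed.

Local Notation zeta := (tens 1 a *: gen Ae x0 : Q n).

(** A coboundary evaluated on the image of the twisted cycle [zeta]; [g] is
    the comparison map, or this map followed by the action of the Nakayama
    automorphism. *)
Lemma coboundary_twisted_trace (sigma : A -> A) (g : forall i, Q i -> P i) f :
  sigma 1 = 1 -> (forall b, sigma (rho 1 b) = rho 1 (sigma b)) ->
  (forall i, {morph @g i : p q / p + q}) ->
  (forall i b c (p : Q i), g i (tens b c *: p) = tens (sigma b) (sigma c) *: g i p) ->
  (forall i p, res_d P i (g i.+1 p) = g i (res_d Q i p)) ->
  cobP f -> tc 1 (f (g n zeta)) = 0.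
Proof.
move=> s1 sr gD gZ gd; have := last_twisted_cycle; rewrite /cob.
case: n x0 f => [|m] x f cyc /=; first by move=> ->; apply: (morphD0 (twisted_classD _ _)).
move=> [h ->]; rewrite gd.
pose L (p : {malg Ae[X m]}) := tc 1 (h (g m p)).
apply: (@twisted_trace_d _ _ _ _ _ m L x a) cyc; rewrite /L.
  by move=> p q; rewrite gD linearD twisted_classD.
move=> b p; rewrite !gZ s1 sr !linearZ /= /GRing.scale /=.
exact: twisted_class_trace.
Qed.

Lemma Theta_last : tc 1 (e (alpha n zeta)) = 1.
Proof.
have -> : alpha n zeta = tens 1 a *: alpha n (gen Ae x0) by rewrite linearZ.
by rewrite eZ twisted_class_mul last_class.
Qed.

(** The comparison maps transport the action on [P] to a semilinear chain map
    of the free resolution, to which [twisted_cycle_invariant] applies. *)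
Lemma rotated_class : tc 1 (e (er_act 1 (alpha n zeta))) = 1.
Proof.
have actD i := ca_add (er_act_compat P i) 1.
have actZ i := ca_compat (er_act_compat P i) 1.
pose g i (p : Q i) : P i := er_act 1 (alpha i p).
have gD i : {morph @g i : p q / p + q} by move=> p q; rewrite /g linearD actD.
have gZ i b c (p : Q i) : g i (tens b c *: p) = tens (rho 1 b) (rho 1 c) *: g i p.
  by rewrite /g linearZ actZ.
have gd i p : res_d P i (g i.+1 p) = g i (res_d Q i p).
  by rewrite /g -alpha_d er_d_act.
have := coboundary_twisted_trace (rmorph1 (rho 1)) (fun b => erefl) gD gZ gd e_homotopy.
rewrite (morphDB (twisted_classD _ _)) => /eqP; rewrite subr_eq0 => /eqP ->.
pose Theta (p : {malg Ae[X n]}) := tc 1 (e (alpha n p)).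
pose phi i (p : {malg Ae[X i]}) : {malg Ae[X i]} := beta i (g i p).
suff inv : Theta (phi n zeta) = Theta zeta by apply: etrans inv Theta_last.
apply: (twisted_cycle_invariant F (mu := rho 1)).
- by move=> i p q; rewrite /phi gD linearD.
- by move=> i b c p; rewrite /phi gZ linearZ.
- by move=> i p; rewrite /phi -[free_lift _ p]/(res_d Q i p) -gd -beta_d.
- move=> p; rewrite /phi -[free_lift _ _]/(res_aug Q _) beta_aug /g er_aug_act.
  by rewrite alpha_aug.
- by move=> p q; rewrite /Theta linearD eD twisted_classD.
- by move=> b p; rewrite /Theta !linearZ !eZ twisted_class_trace.
- move=> p; rewrite /Theta -[free_lift _ p]/(res_d Q n p) -alpha_d e_d.
  exact: (morphD0 (twisted_classD _ _)).
exact: last_twisted_cycle.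
Qed.

(** The value of [gact (-1) e] on [zeta] is 1 because [zeta] is invariant, and
    that of [kact c e] is [c]. *)
Lemma hdet_of_action (c : k) : ext_eq (gact (-1) e) (kact c e) -> c = 1.
Proof.
have aD i : {morph alpha i : p q / p + q} by exact: linearD.
have aZ i b b' (p : Q i) : alpha i (tens b b' *: p) = tens b b' *: alpha i p.
  by rewrite linearZ.
move=> ce; have := coboundary_twisted_trace (sigma := id) erefl (fun b => erefl)
  aD aZ alpha_d ce.
rewrite /gact /kact opprK (morphDB (twisted_classD _ _)) twisted_classZ Theta_last.
have -> t : tc 1 (Aenv_map (rho (-1)) t) = rho (-1) (tc 1 t).
  move: t; apply: Aenv_morph_eq => [t u|t u|u v].
  - by rewrite Aenv_mapD twisted_classD.
  - by rewrite twisted_classD rmorphD.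
  rewrite Aenv_map_tens !twisted_class_tens !mulr1 rmorphM; congr (_ * _).
  by rewrite -[LHS]zaD -[RHS]zaD addrC.
rewrite rotated_class rmorph1 => /eqP; rewrite subr_eq0 => /eqP c1.
by apply: (@in_alg_injective k A); rewrite /= -c1 scale1r.
Qed.
End WithClass.
End Main.

Theorem corollary2 (k : fieldType) (A : algType k) (G : connected_grading A)
    (n : nat) (A_AS_regular : AS_regular G n)
    (rho : graded_Zaction G) (P : equivariant_resolution rho)
    (e : cochain P n) (e_gen : free_generator e)
    (mu : {lrmorphism A -> A}) (mu_Nakayama : Nakayama e mu)
    (rho_mu : forall a : A, rho 1 a = mu a)
    (hdet : {lrmorphism kZZ k -> k^o})
    (hdetP : homological_determinant e hdet) :
  hdet (grp k 1) = 1.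
Proof.
have eN : Nakayama e (rho 1) by move=> a; rewrite rho_mu; apply: mu_Nakayama.
have projP : projective_resolution P.
  move=> i; apply: (equivariant_projective_projective (er_act_compat P i)).
  exact: er_proj.
have [X [d [aug F]]] := minimal_free_resolution_exists (regular_bimodule G).
have projQ := @free_resolution_projective _ _ _ _ _ _ _ F.
have [[x0 x0_uniq] n_last] := last_generator (base_change_resolution F)
  (as_gldim A_AS_regular) (as_left A_AS_regular).
have [alpha [alpha_d alpha_aug]] := comparison P projQ.
have [beta [beta_d beta_aug]] := comparison (free_resolution F) projP.
have [H [H0 HS]] := comparison_homotopy projP beta_d beta_aug alpha_d alpha_aug.
have [a a_class] := coeff_class e_gen x0 n_last beta_d.
apply: (hdet_of_action e_gen eN x0_uniq alpha_d alpha_aug beta_d beta_aug H0 HS a_class).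
by have := hdetP (-1); rewrite opprK.
Qed.
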